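(* For any integer $d\geq 1$ and any $\varepsilon >0$, there exist an integer $n$ and a real symmetric positive semidefinite matrix $C\in\mathbb{R}^{dn\times dn}$ with $d\times d$ blocks $C_{ij}$ such that \[ \frac{\displaystyle{\max_{O_1,\dots,O_n \in \mathcal{O}_d} \sum_{i=1}^n\sum_{j=1}^n\operatorname{tr}\left(C_{ij}^TO_iO_j^T\right)}}{\displaystyle{\max_{\substack{ X_iX_i^T=I_{d\times d} \\ X_i\in\mathbb{R}^{d\times dn} }} \sum_{i=1}^n\sum_{j=1}^n\operatorname{tr}\left(C_{ij}^TX_iX_j^T\right)}}\leq \alpha_{\mathbb{R}}(d)^2 + \varepsilon. \]
   Context: $\mathcal{O}_d$ is the group of real $d\times d$ orthogonal matrices. For $G\in\mathbb{R}^{d\times d}$ with i.i.d. real $\mathcal{N}(0,d^{-1})$ entries, $\alpha_{\mathbb{R}}(d)=\mathbb{E}\left[\frac1d\sum_{j=1}^d\sigma_j(G)\right]$, where $\sigma_j$ is the $j$-th singular value. *)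

(* Defs.v *)
From HB Require Import structures.
From mathcomp Require Import all_boot all_order all_algebra.
From mathcomp Require Import all_classical all_reals all_analysis.
Set Implicit Arguments. Unset Strict Implicit. Unset Printing Implicit Defensive.
Import Order.TTheory GRing.Theory Num.Theory.
Local Open Scope classical_set_scope.
Local Open Scope ring_scope.

Section Defs.
Context {R : realType}.

Definition orthogonal {d : nat} (O : 'M[R]_d) : Prop := O *m O^T = 1%:M.

Definition is_singular_values {d : nat} (G : 'M[R]_d) (sigma : 'rV[R]_d) : Prop :=
  (forall j, 0 <= sigma 0 j) /\
  exists U V : 'M[R]_d, orthogonal U /\ orthogonal V /\
    G = U *m diag_mx sigma *m V^T.

(* sum_{j=1}^d sigma_j(G) (independent of the chosen SVD). *)
Definition sum_singular_values {d : nat} (G : 'M[R]_d) : R :=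
  xget 0 [set t | exists sigma : 'rV[R]_d,
                    is_singular_values G sigma /\ t = \sum_(j < d) sigma 0 j].

(* Iterated integral of F over the coordinates 0 .. k-1 of g : nat -> R,
   each coordinate distributed as N(0, s^2) (s = standard deviation),
   i.e. the expectation of F w.r.t. the product Gaussian measure. *)
Fixpoint gauss_iter (s : R) (k : nat) (F : (nat -> R) -> \bar R) : \bar R :=
  match k with
  | 0 => F (fun _ => 0)
  | k'.+1 => (\int[normal_prob 0 s]_x
               gauss_iter s k' (fun g => F (fun i => if i == k' then x else g i)))%E
  end.

(* alpha_R(d) = E[ (1/d) sum_j sigma_j(G) ], G with i.i.d. N(0, 1/d) entries. *)
Definition alpha_R (d : nat) : R :=
  fine (gauss_iter (Num.sqrt (d%:R))^-1 (d * d)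
    (fun g => (sum_singular_values (\matrix_(i < d, j < d) g (i * d + j)%N)
               / d%:R)%:E)).

Definition block {n d : nat} (C : 'M[R]_(n * d)) (i j : 'I_n) : 'M[R]_d :=
  \matrix_(a < d, b < d) C (mxvec_index i a) (mxvec_index j b).

Definition sym_psd {m : nat} (C : 'M[R]_m) : Prop :=
  C^T = C /\ forall v : 'rV[R]_m, 0 <= (v *m C *m v^T) 0 0.

Definition orth_value {n d : nat} (C : 'M[R]_(n * d)) : R :=
  sup [set t | exists O : 'I_n -> 'M[R]_d, (forall i, orthogonal (O i)) /\
        t = \sum_(i < n) \sum_(j < n) \tr ((block C i j)^T *m O i *m (O j)^T)].

Definition sdp_value {n d : nat} (C : 'M[R]_(n * d)) : R :=
  sup [set t | exists X : 'I_n -> 'M[R]_(d, n * d),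
        (forall i, X i *m (X i)^T = 1%:M) /\
        t = \sum_(i < n) \sum_(j < n) \tr ((block C i j)^T *m X i *m (X j)^T)].

End Defs.

(* Main.v *)
Require Import Defs.
From HB Require Import structures.
From mathcomp Require Import all_boot all_order all_algebra.
From mathcomp Require Import all_classical all_reals all_analysis.
From mathcomp Require Import measurable_realfun.
From mathcomp Require Import ring lra.
Import Order.TTheory GRing.Theory Num.Theory.
Import numFieldNormedType.Exports.
Local Open Scope classical_set_scope.
Local Open Scope ring_scope.
Set Implicit Arguments. Unset Strict Implicit. Unset Printing Implicit Defensive.

(* Let [V] be a [d x D] matrix with i.i.d. N(0, 1/d) entries and consider the
   Gram matrix with blocks [V_i V_j^T], [V_i] ranging over the values of [V]
   weighted by their probabilities. Its value at [X] is [|E (V^T X_V)|^2].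

   For orthogonal [O_V], dualising against a unit vector [Y] (a [D x d] matrix)
   bounds the value by the square of the maximum of [E (nuc (V Y))], where
   [nuc] is the sum of the singular values, i.e. the maximum of [tr (A^T O)].
   By rotation invariance [Y] may be replaced by a [d x d] matrix [T], by
   elimination with plane rotations. Averaging over the signed cyclic shifts of
   the rows of [T] then bounds [E (nuc (G T))] by [E (nuc G) / sqrt d], which
   is [sqrt d * alpha].

   For the relaxation, take for [X_V] the polar factor of [V]; since
   [nuc (V / r) >= 3/2 tr A - 1/2 tr A^2] with [A = V^T V / r^2], second and
   fourth moments show that the value tends to [d] as [D] tends to infinity.

   To have finitely many blocks, the Gaussian is replaced by a symmetric law
   with finite support, close to it on Lipschitz functions; then rotation
   invariance holds only approximately, while independence, permutations and
   sign changes of the coordinates are exact finite sums. *)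

(** Every error is quantified because [C] must be finite. Passing from the Gaussian to a finite law
    costs a multiple of [delta] per coordinate, and eliminating a [D x d] matrix takes up to [d * D]
    rotations, each acting on all [d] rows of [G]; so the total error grows with [D]. The parameters
    are chosen in the order [eta], [D], [delta]. This is possible because the size of [D] depends on
    a fourth moment bound that is the same for all [delta]: the finite law rounds the Gaussian
    towards zero.

    Plane rotations are used because then only two coordinates at a time are compared with the
    Gaussian, whose invariance reduces to that of planar Lebesgue measure under shears. The shears
    exclude the half-turn, whence the condition [0 <= c] throughout.

    Lipschitz bounds carry the comparison: they survive the integration of a coordinate, and they
    supply the measurability and integrability of [nuc] and of its partial integrals.

    The two bounds are close to [d * alpha ^ 2] and [d], which gives the quotient. *)

Local Notation orthogonal := Defs.orthogonal.
Local Notation nuc := sum_singular_values.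

(** * Orthogonal matrices, coisometries and plane rotations *)

Section OrthogonalMatrices.
Context {R : realType}.

Lemma orthogonal_tr d (O : 'M[R]_d) : orthogonal O -> O^T *m O = 1%:M.
Proof. exact: mulmx1C. Qed.

Lemma orthogonalT d (O : 'M[R]_d) : orthogonal O -> orthogonal O^T.
Proof. by move=> /orthogonal_tr h; rewrite /orthogonal trmxK. Qed.

Lemma orthogonalM d (A B : 'M[R]_d) :
  orthogonal A -> orthogonal B -> orthogonal (A *m B).
Proof.
rewrite /orthogonal => hA hB.
by rewrite trmx_mul mulmxA -(mulmxA A) hB mulmx1.
Qed.

Lemma orthogonal1 d : orthogonal (1%:M : 'M[R]_d).
Proof. by rewrite /orthogonal trmx1 mulmx1. Qed.

Lemma coisometry_row m n (X : 'M[R]_(m, n)) i :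
  X *m X^T = 1%:M -> \sum_j X i j ^+ 2 = 1.
Proof.
move=> /matrixP/(_ i i); rewrite !mxE eqxx mulr1n => <-.
by apply: eq_bigr => j _; rewrite mxE expr2.
Qed.

Lemma coisometry_le1 m n (X : 'M[R]_(m, n)) i j :
  X *m X^T = 1%:M -> `|X i j| <= 1.
Proof.
move=> /(@coisometry_row _ _ _ i); rewrite (bigD1 j)//= => h.
rewrite -(@ler_pXn2r _ 2%N) ?nnegrE// real_normK ?num_real// expr1n -h.
by rewrite lerDl sumr_ge0// => k _; rewrite sqr_ge0.
Qed.

Lemma mxtrace_mul m n (A : 'M[R]_(m, n)) (B : 'M[R]_(m, n)) :
  \tr (A^T *m B) = \sum_i \sum_j A i j * B i j.
Proof.
rewrite /mxtrace exchange_big/=; apply: eq_bigr => j _; rewrite mxE.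
by apply: eq_bigr => i _; rewrite mxE.
Qed.

Lemma continuous_sumr (T : topologicalType) (I : Type) (r : seq I)
  (F : I -> T -> R) : (forall i, continuous (F i)) ->
  continuous (fun t => \sum_(i <- r) F i t).
Proof.
move=> cF; elim: r => [|i r ih].
  under [X in continuous X]eq_fun do rewrite big_nil.
  exact: cst_continuous.
under [X in continuous X]eq_fun do rewrite big_cons.
by move=> t; apply: cvgD; [exact: cF|exact: ih].
Qed.

Lemma continuous_mulr (T : topologicalType) (f g : T -> R) :
  continuous f -> continuous g -> continuous (fun t => f t * g t).
Proof. by move=> cf cg t; apply: cvgM; [exact: cf|exact: cg]. Qed.

Definition givens n (p q : 'I_n) (c s : R) : 'M[R]_n :=
  \matrix_(i, j) if i == p then c * (j == p)%:R + s * (j == q)%:R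
                 else if i == q then - s * (j == p)%:R + c * (j == q)%:R
                 else (i == j)%:R.

Lemma givens_mul n m (p q : 'I_n) c s (A : 'M[R]_(n, m)) i j : p != q ->
  (givens p q c s *m A) i j =
    if i == p then c * A p j + s * A q j
    else if i == q then - s * A p j + c * A q j else A i j.
Proof.
move=> pq; rewrite mxE.
have sum1 (k : 'I_n) : \sum_l (l == k)%:R * A l j = A k j.
  rewrite (bigD1 k)//= eqxx mul1r big1 ?addr0// => l /negbTE ->.
  by rewrite mul0r.
have sum2 a b : \sum_l (a * (l == p)%:R + b * (l == q)%:R) * A l j
    = a * A p j + b * A q j.
  under eq_bigr do rewrite mulrDl -!mulrA.
  by rewrite big_split/= -!mulr_sumr !sum1.
under eq_bigr do rewrite mxE.
case: ifP => _; first exact: sum2.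
case: ifP => _; first exact: sum2.
by under eq_bigr do rewrite eq_sym; rewrite sum1.
Qed.

Lemma givens_orthogonal n (p q : 'I_n) c s : p != q ->
  c ^+ 2 + s ^+ 2 = 1 -> orthogonal (givens p q c s).
Proof.
move=> pq cs; apply/matrixP => i j; rewrite givens_mul// !mxE.
have qp : (q == p) = false by rewrite eq_sym (negbTE pq).
rewrite !eqxx qp (negbTE pq).
have [?|ip] := eqVneq i p; first subst i.
  have [?|jp] := eqVneq j p; first by transitivity (c ^+ 2 + s ^+ 2); rewrite /=; [ring|rewrite cs].
  have [?|jq] := eqVneq j q; first by rewrite /=; ring.
  by rewrite /=; ring.
have [?|iq] := eqVneq i q; first subst i.
  have [?|jp] := eqVneq j p; first by subst j; rewrite (negbTE ip)/=; ring.
  have [?|jq] := eqVneq j q; first by transitivity (c ^+ 2 + s ^+ 2); rewrite /=; [ring|rewrite cs].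
  by rewrite /=; ring.
have [?|jp] := eqVneq j p; first by subst j; rewrite (negbTE ip)/=; ring.
have [?|jq] := eqVneq j q; first by subst j; rewrite (negbTE iq)/=; ring.
by rewrite eq_sym.
Qed.

End OrthogonalMatrices.

(** * Existence of singular value decompositions *)

Section SingularValues.
Context {R : realType}.

(** Lagrange's identity: the sum of the squared 2 x 2 minors is twice the difference of the two
    sides. *)
Lemma cauchy_schwarz (I : finType) (x y : I -> R) :
  (\sum_i x i * y i) ^+ 2 <= (\sum_i x i ^+ 2) * (\sum_i y i ^+ 2).
Proof.
have : 0 <= \sum_i \sum_j (x i * y j - x j * y i) ^+ 2.
  by apply: sumr_ge0 => i _; apply: sumr_ge0 => j _; exact: sqr_ge0.
have -> : \sum_i \sum_j (x i * y j - x j * y i) ^+ 2 =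
    \sum_i \sum_j (x i ^+ 2 * y j ^+ 2 + y i ^+ 2 * x j ^+ 2
                   + (- 2 * (x i * y i)) * (x j * y j)).
  by apply: eq_bigr => i _; apply: eq_bigr => j _; ring.
under eq_bigr do rewrite !big_split/= -!mulr_sumr.
rewrite !big_split/= -!mulr_suml -mulr_sumr.
by lra.
Qed.

(** A first-order condition without derivatives: with [r] the length of [(P, S)], the form takes the
    value [r] at [(P / r, S / r)], so [r <= P] and [S] vanishes. *)
Lemma max_cos_sin (P S : R) :
  (forall c s, c ^+ 2 + s ^+ 2 = 1 -> c * P + s * S <= P) -> S = 0.
Proof.
move=> H; apply/eqP; apply: contraT => S0.
have r0 : 0 < P ^+ 2 + S ^+ 2.
  by rewrite ltr_wpDl ?sqr_ge0// exprn_even_gt0.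
set r := Num.sqrt (P ^+ 2 + S ^+ 2).
have rg : 0 < r by rewrite sqrtr_gt0.
have r2 : r ^+ 2 = P ^+ 2 + S ^+ 2 by rewrite sqr_sqrtr// ltW.
have := H (P / r) (S / r).
have -> : (P / r) ^+ 2 + (S / r) ^+ 2 = 1.
  by rewrite !expr_div_n -mulrDl -r2 divff// lt0r_neq0// exprn_gt0.
have -> : P / r * P + S / r * S = r.
  have -> : P / r * P + S / r * S = (P ^+ 2 + S ^+ 2) / r by field; rewrite gt_eqF.
  by rewrite -r2 expr2 mulfK// gt_eqF.
move=> /(_ erefl) rP; have S2 : 0 < S ^+ 2 by rewrite exprn_even_gt0.
have : r ^+ 2 <= P ^+ 2 by rewrite ler_pXn2r// nnegrE ?(ltW rg)// (le_trans (ltW rg)).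
by lra.
Qed.

(** Compactness: orthogonality is a finite set of polynomial equations and bounds the entries by 1.
    Both matrices are packed into one row vector, the setting of the extreme value theorem
    [EVT_max_rV]. *)
Lemma orthogonal_pair_max n (J : 'M[R]_n -> 'M[R]_n -> R) :
  continuous (fun v : 'rV[R]_(n * n + n * n) =>
    J (vec_mx (lsubmx v)) (vec_mx (rsubmx v))) ->
  exists U V, [/\ orthogonal U, orthogonal V &
    forall U' V', orthogonal U' -> orthogonal V' -> J U' V' <= J U V].
Proof.
move=> cJ.
pose L (v : 'rV[R]_(n * n + n * n)) : 'M[R]_n := vec_mx (lsubmx v).
pose Q (v : 'rV[R]_(n * n + n * n)) : 'M[R]_n := vec_mx (rsubmx v).
pose A := [set v | orthogonal (L v) /\ orthogonal (Q v)].
have LE v i j : L v i j = v 0 (lshift _ (mxvec_index i j)) by rewrite !mxE.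
have QE v i j : Q v i j = v 0 (rshift _ (mxvec_index i j)) by rewrite !mxE.
have cent (w : 'I_n -> 'I_n -> 'I_(n * n + n * n)) :
    closed [set v : 'rV[R]_(n * n + n * n) |
       forall i j, \sum_k v 0 (w i k) * v 0 (w j k) = (i == j)%:R].
  rewrite [X in closed X](_ : _ = \bigcap_i \bigcap_j
     [set v : 'rV[R]_(n * n + n * n) | \sum_k v 0 (w i k) * v 0 (w j k) = (i == j)%:R]).
    apply: closed_bigI => i _; apply: closed_bigI => j _.
    have cF : continuous (fun v : 'rV[R]_(n * n + n * n) =>
        \sum_k v 0 (w i k) * v 0 (w j k)).
      apply: continuous_sumr => k; apply: continuous_mulr; exact: coord_continuous.
    by apply: (preimage_closed _ (@closed_eq R _)) => v _; exact: cF.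
  apply/seteqP; split => [v h i _ j _|v h i j]; first exact: h.
  exact: (h i Logic.I j Logic.I).
have clA : closed A.
  pose wl i j : 'I_(n * n + n * n) := lshift (n * n) (@mxvec_index n n i j).
  pose wr i j : 'I_(n * n + n * n) := rshift (n * n) (@mxvec_index n n i j).
  rewrite (_ : A = [set v : 'rV[R]_(n * n + n * n) |
       forall i j, \sum_k v 0 (wl i k) * v 0 (wl j k) = (i == j)%:R] `&`
     [set v : 'rV[R]_(n * n + n * n) |
       forall i j, \sum_k v 0 (wr i k) * v 0 (wr j k) = (i == j)%:R]).
    by apply: closedI; exact: cent.
  have orthE (M : 'M[R]_n) : orthogonal M <->
      (forall i j, \sum_k M i k * M j k = (i == j)%:R).
    split => [/matrixP h i j|h].
      have := h i j; rewrite !mxE => <-.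
      by apply: eq_bigr => k _; rewrite mxE.
    apply/matrixP => i j; rewrite !mxE -h.
    by apply: eq_bigr => k _; rewrite mxE.
  apply/seteqP; split => v /= [h1' h2'];
    [have h1 := (orthE _).1 h1'; have h2 := (orthE _).1 h2'
    |have h1 := h1'; have h2 := h2']; split => /=.
  - by move=> i j; rewrite -h1; apply: eq_bigr => k _; rewrite !LE.
  - by move=> i j; rewrite -h2; apply: eq_bigr => k _; rewrite !QE.
  - by apply/orthE => i j; rewrite -h1; apply: eq_bigr => k _; rewrite !LE.
  - by apply/orthE => i j; rewrite -h2; apply: eq_bigr => k _; rewrite !QE.
have bA : bounded_set A.
  exists 1; split => // x x1 v [h1 h2] /=.
  apply: (le_trans _ (ltW x1)).
  rewrite [leLHS]/Num.Def.normr /= mx_normrE; apply/bigmax_leP; split => // -[i j] _ /=.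
  rewrite (ord1 i) -(splitK j); case: (fintype.split j) => k /=;
    case/mxvec_indexP: k => a b.
    by rewrite -LE; exact: coisometry_le1.
  by rewrite -QE; exact: coisometry_le1.
have A0 : A !=set0.
  exists (row_mx (mxvec 1%:M) (mxvec 1%:M)).
  by rewrite /A /L /Q /= row_mxKl row_mxKr mxvecK; split; exact: orthogonal1.
have [v] := EVT_max_rV A0 (bounded_closed_compact bA clA)
  (continuous_subspaceT cJ).
rewrite inE => -[h1 h2] hm; exists (L v), (Q v); split => // U V hU hV.
have := hm (row_mx (mxvec U) (mxvec V)).
by rewrite row_mxKl row_mxKr !mxvecK; apply; rewrite inE /A /L /Q /= row_mxKl row_mxKr !mxvecK.
Qed.

Lemma sign_flip_orthogonal n (p : 'I_n) :
  orthogonal (diag_mx (\row_j (if j == p then -1 else 1)) : 'M[R]_n).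
Proof.
rewrite /Defs.orthogonal tr_diag_mx mulmx_diag -diag_const_mx; congr diag_mx.
by apply/rowP => j; rewrite !mxE; case: ifP => _; rewrite ?mulrNN mulr1.
Qed.

Lemma singular_values_exist n (G : 'M[R]_n) :
  exists sigma, is_singular_values G sigma.
Proof.
(* Maximise [\sum_i (i + 1) (U^T G V) i i]: since the weights are distinct,
   stationarity under plane rotations on both sides kills the off-diagonal
   entries. *)
pose w (i : 'I_n) : R := i.+1%:R.
pose J (U V : 'M[R]_n) := \sum_i w i * (U^T *m G *m V) i i.
have [|U [V [oU oV Jmax]]] := @orthogonal_pair_max n J.
  rewrite [X in continuous X](_ : _ = fun v : 'rV[R]_(n * n + n * n) =>
    \sum_i w i * (\sum_b (\sum_a v 0 (lshift _ (mxvec_index a i)) * G a b)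
                   * v 0 (rshift _ (mxvec_index b i)))).
    apply: continuous_sumr => i; apply: continuous_mulr; first exact: cst_continuous.
    apply: continuous_sumr => b; apply: continuous_mulr; last exact: coord_continuous.
    apply: continuous_sumr => a; apply: continuous_mulr; first exact: coord_continuous.
    exact: cst_continuous.
  apply/funext => v; apply: eq_bigr => i _; rewrite mxE; congr (_ * _).
  apply: eq_bigr => b _; rewrite !mxE; congr (_ * _).
  by apply: eq_bigr => a _; rewrite !mxE.
have [B BE] : exists B, B = U^T *m G *m V by eexists.
have leftmax Q : orthogonal Q -> \sum_i w i * (Q *m B) i i <= \sum_i w i * B i i.
  move=> oQ; have := Jmax (U *m Q^T) V; rewrite /J trmx_mul trmxK.
  by rewrite -!(mulmxA Q) -BE; apply => //; apply: orthogonalM => //; exact: orthogonalT.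
have rightmax Q : orthogonal Q -> \sum_i w i * (Q *m B^T) i i <= \sum_i w i * B i i.
  move=> oQ; have oVQ : orthogonal (V *m Q^T) by apply: orthogonalM => //; exact: orthogonalT.
  have := Jmax _ _ oU oVQ.
  have -> : J U (V *m Q^T) = \sum_i w i * (Q *m B^T) i i.
    apply: eq_bigr => i _; congr (_ * _).
    by rewrite -[in RHS](trmxK Q) -trmx_mul [RHS]mxE BE !mulmxA.
  by rewrite /J -BE.
have stat (A : 'M[R]_n) p q : p != q ->
    (forall Q, orthogonal Q -> \sum_i w i * (Q *m A) i i <= \sum_i w i * A i i) ->
    w p * A q p = w q * A p q.
  move=> pq H; apply/eqP; rewrite -subr_eq0; apply/eqP.
  apply: (@max_cos_sin (w p * A p p + w q * A q q)) => c s cs.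
  have qp : q != p by rewrite eq_sym.
  have := H _ (givens_orthogonal pq cs).
  rewrite (bigD1 p)//= (bigD1 q)//= [leRHS](bigD1 p)//= [in leRHS](bigD1 q)//=.
  rewrite !givens_mul// eqxx (negbTE qp) eqxx.
  rewrite [X in _ + (_ + X) <= _](_ : _ =
    \sum_(i < n | (i != p) && (i != q)) w i * A i i); last first.
    by apply: eq_bigr => i /andP[ip iq]; rewrite givens_mul// (negbTE ip) (negbTE iq).
  by lra.
have Boff p q : p != q -> B q p = 0.
  move=> pq.
  (* Left and right stationarity form a linear system in [B q p] and [B p q] with determinant
     [w p ^+ 2 - w q ^+ 2]. *)
  have h1 := stat B p q pq leftmax.
  have h2 : w p * B p q = w q * B q p.
    have := stat B^T p q pq; rewrite !mxE; apply => Q oQ.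
    under [leRHS]eq_bigr do rewrite mxE.
    exact: rightmax.
  have wp : 0 < w p by rewrite ltr0n.
  have wq : 0 < w q by rewrite ltr0n.
  have wpq : w p ^+ 2 - w q ^+ 2 != 0.
    rewrite subr_eq0 eqrXn2 ?ltW// /w eqr_nat eqSS.
    by apply: contra pq => /eqP h; apply/eqP/val_inj.
  have : (w p ^+ 2 - w q ^+ 2) * B q p = 0.
    by rewrite mulrBl expr2 -mulrA h1 mulrCA h2 expr2 mulrA subrr.
  by move/eqP; rewrite mulf_eq0 (negbTE wpq) => /eqP.
(* Flipping the sign of row [p] negates only the [p]-th term of the weighted trace. *)
have Bdiag p : 0 <= B p p.
  have := leftmax _ (sign_flip_orthogonal p).
  rewrite (bigD1 p)//= [leRHS](bigD1 p)//= mul_diag_mx !mxE eqxx.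
  rewrite [X in _ + X <= _](_ : _ = \sum_(i < n | i != p) w i * B i i); last first.
    by apply: eq_bigr => i ip; rewrite !mxE (negbTE ip) mul1r.
  have wp : 0 < w p by rewrite ltr0n.
  rewrite lerD2r mulN1r mulrN => h.
  have : 0 <= w p * B p p by move: h; set x := w p * B p p; lra.
  by rewrite pmulr_rge0.
exists (\row_j B j j); split; first by move=> j; rewrite mxE.
exists U, V; split => //; split => //.
have <- : B = diag_mx (\row_j B j j).
  apply/matrixP => i j; rewrite !mxE.
  by have [->|ij] := eqVneq i j; rewrite ?mulr1n// mulr0n Boff// eq_sym.
by rewrite BE !mulmxA oU mul1mx -mulmxA oV mulmx1.
Qed.

End SingularValues.

(** * The trace norm as a maximum over orthogonal matrices *)

Section NuclearNorm.
Context {R : realType}.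

(** Existence of a decomposition ensures that [xget] does not fall back on its default 0. *)
Lemma sum_singular_valuesP n (G : 'M[R]_n) :
  exists2 sigma, is_singular_values G sigma & nuc G = \sum_j sigma 0 j.
Proof.
have : exists t, [set t | exists sigma : 'rV[R]_n,
    is_singular_values G sigma /\ t = \sum_(j < n) sigma 0 j] t.
  by have [sigma hs] := singular_values_exist G; exists (\sum_j sigma 0 j), sigma.
by move=> /(xgetPex 0)[sigma [h1 h2]]; exists sigma.
Qed.

Lemma nuc_ge0 n (G : 'M[R]_n) : 0 <= nuc G.
Proof. by have [s [s0 _] ->] := sum_singular_valuesP G; apply: sumr_ge0. Qed.

Lemma sqr_sum_mulmx m n (U : 'M[R]_(m, n)) (v : 'cV[R]_n) :
  U^T *m U = 1%:M -> \sum_i (U *m v) i 0 ^+ 2 = \sum_j v j 0 ^+ 2.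
Proof.
have E p (w : 'cV[R]_p) : \sum_i w i 0 ^+ 2 = (w^T *m w) 0 0.
  by rewrite mxE; apply: eq_bigr => i _; rewrite mxE expr2.
by move=> h; rewrite !E trmx_mul mulmxA -(mulmxA v^T) h mulmx1.
Qed.

(** Duality of trace norm and operator norm: in singular bases of [G] the trace is a combination of
    diagonal entries of [U^T *m B *m V], each at most [b]. Squared lengths are the form in which an
    average of matrices is estimated later. *)
Lemma mxtrace_le_nuc n (G B : 'M[R]_n) (b : R) : 0 <= b ->
  (forall v : 'cV[R]_n, \sum_i (B *m v) i 0 ^+ 2 <= b ^+ 2 * \sum_i v i 0 ^+ 2) ->
  \tr (G^T *m B) <= b * nuc G.
Proof.
move=> b0 hB; have [s [s0 [U [V [oU [oV GE]]]]] ->] := sum_singular_valuesP G.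
have -> : \tr (G^T *m B) = \sum_j s 0 j * (U^T *m B *m V) j j.
  rewrite GE !trmx_mul trmxK tr_diag_mx -!mulmxA mxtrace_mulC !mulmxA.
  rewrite /mxtrace; apply: eq_bigr => j _.
  by rewrite -!mulmxA mul_diag_mx mxE.
rewrite mulr_sumr; apply: ler_sum => j _; rewrite mulrC ler_wpM2r//.
have vj : \sum_i V i j ^+ 2 = 1.
  rewrite -(@coisometry_row R _ _ V^T j); last by rewrite trmxK orthogonal_tr.
  by apply: eq_bigr => i _; rewrite mxE.
have h : (U^T *m B *m V) j j ^+ 2 <= b ^+ 2.
  have := hB (col j V); under [X in _ <= _ * X -> _]eq_bigr do rewrite mxE.
  rewrite vj mulr1; apply: le_trans.
  rewrite -(@sqr_sum_mulmx _ _ U^T (B *m col j V)); last by rewrite trmxK.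
  have <- : (U^T *m (B *m col j V)) j 0 = (U^T *m B *m V) j j.
    by rewrite mulmxA [LHS]mxE [RHS]mxE; apply: eq_bigr => k _; rewrite [col _ _ _ _]mxE.
  rewrite [leRHS](bigD1 j)//=.
  by rewrite lerDl sumr_ge0// => i _; rewrite sqr_ge0.
have [?|x0] := leP ((U^T *m B *m V) j j) 0; first exact: le_trans b0.
by move: h; rewrite ler_pXn2r// nnegrE// ltW.
Qed.

Lemma mxtrace_orthogonal_le_nuc n (G O : 'M[R]_n) :
  orthogonal O -> \tr (G^T *m O) <= nuc G.
Proof.
move=> oO; rewrite -[leRHS]mul1r; apply: mxtrace_le_nuc => // v.
by rewrite expr1n mul1r sqr_sum_mulmx// orthogonal_tr.
Qed.

Lemma nuc_attained n (G : 'M[R]_n) :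
  exists2 O, orthogonal O & nuc G = \tr (G^T *m O).
Proof.
have [s [s0 [U [V [oU [oV GE]]]]] ->] := sum_singular_valuesP G.
exists (U *m V^T); first by apply: orthogonalM => //; exact: orthogonalT.
rewrite GE !trmx_mul trmxK tr_diag_mx -!mulmxA (mulmxA U^T) orthogonal_tr//.
rewrite mul1mx mxtrace_mulC -mulmxA orthogonal_tr// mulmx1 mxtrace_diag.
by [].
Qed.

(** Testing both matrices against the optimal orthogonal matrix of one of them leaves the entries of
    the difference with coefficients of modulus at most 1. The entrywise l1 norm suits an exchange
    of coordinates one by one. *)
Lemma nuc_lipschitz n (A B : 'M[R]_n) :
  `|nuc A - nuc B| <= \sum_i \sum_j `|A i j - B i j|.
Proof.
have half (M N : 'M[R]_n) : nuc M - nuc N <= \sum_i \sum_j `|M i j - N i j|.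
  have [ Q oQ ->] := nuc_attained M.
  rewrite (le_trans (lerB (lexx _) (mxtrace_orthogonal_le_nuc N oQ)))//.
  rewrite -linearB/= -mulmxBl -linearB/= mxtrace_mul.
  apply: ler_sum => i _; apply: ler_sum => j _; rewrite !mxE.
  rewrite (le_trans (ler_norm _))// normrM ler_piMr//.
  exact: coisometry_le1.
rewrite ler_norml half andbT lerNl opprB (le_trans (half _ _))//.
by apply: ler_sum => i _; apply: ler_sum => j _; rewrite distrC.
Qed.

(* [3/2 b^2 - 1/2 b^4 <= b] for [b >= 0], applied to the singular values of
   [V / r], bounds the trace norm from below by polynomial moments. *)
Lemma coisometry_trace_ge d k (V : 'M[R]_(d, d + k)) (r : R) : 0 < r ->
  exists2 X : 'M[R]_(d, d + k), X *m X^T = 1%:M &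
   r * (3 / 2 * (\tr (V^T *m V) / r ^+ 2)
        - 2^-1 * (\tr (V^T *m V *m (V^T *m V)) / r ^+ 4)) <= \tr (V^T *m X).
Proof.
(* Zero rows make the matrix square; the upper [d] rows of its orthogonal polar factor are the
   coisometry. *)
move=> r0; pose P : 'M[R]_(d + k) := col_mx V 0.
have [s [s0 [U [W [oU [oW PE]]]]]] := singular_values_exist P.
have oO : orthogonal (U *m W^T) by apply: orthogonalM => //; exact: orthogonalT.
set O := U *m W^T in oO; exists (usubmx O).
  have := oO; rewrite /Defs.orthogonal -{1 2}(vsubmxK O) tr_col_mx mul_col_row.
  by rewrite (@scalar_mx_block _ d k 1) => /eq_block_mx[].
have PP : P^T *m P = V^T *m V.
  by rewrite /P tr_col_mx trmx0 mul_row_col mul0mx addr0.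
have -> : \tr (V^T *m usubmx O) = \sum_j s 0 j.
  transitivity (\tr (P^T *m O)).
    by rewrite -{2}(vsubmxK O) /P tr_col_mx trmx0 mul_row_col mul0mx addr0.
  rewrite PE !trmx_mul trmxK tr_diag_mx -!mulmxA (mulmxA U^T) orthogonal_tr//.
  by rewrite mul1mx mxtrace_mulC -mulmxA orthogonal_tr// mulmx1 mxtrace_diag.
have PPE : V^T *m V = W *m diag_mx (\row_j s 0 j ^+ 2) *m W^T.
  rewrite -PP PE !trmx_mul trmxK tr_diag_mx -!mulmxA (mulmxA U^T) orthogonal_tr//.
  rewrite mul1mx (mulmxA (diag_mx s)) mulmx_diag; congr (_ *m (diag_mx _ *m _)).
have -> : \tr (V^T *m V) = \sum_j s 0 j ^+ 2.
  rewrite PPE -mulmxA mxtrace_mulC -mulmxA orthogonal_tr// mulmx1 mxtrace_diag.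
  by apply: eq_bigr => j _; rewrite mxE.
have -> : \tr (V^T *m V *m (V^T *m V)) = \sum_j s 0 j ^+ 4.
  rewrite PPE -!mulmxA (mulmxA W^T W) orthogonal_tr// mul1mx mxtrace_mulC -!mulmxA.
  rewrite orthogonal_tr// mulmx1 mulmx_diag mxtrace_diag.
  by apply: eq_bigr => j _; rewrite !mxE -exprD.
rewrite !mulr_suml !mulr_sumr -sumrB mulr_sumr; apply: ler_sum => j _.
have sr : 0 <= s 0 j / r by rewrite divr_ge0// ltW.
rewrite -!expr_div_n -[leRHS](@divfK _ r) ?gt_eqF// [leRHS]mulrC ler_pM2l//.
set b := s 0 j / r in sr *.
(* The zero at 0 and the double zero at 1 make the estimate sharp when all singular values of [V]
   are 0 or [r]. *)
rewrite -subr_ge0 (_ : b - _ = 2^-1 * b * (b - 1) ^+ 2 * (b + 2)); last by field.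
apply: mulr_ge0; last exact: addr_ge0.
apply: mulr_ge0; last exact: sqr_ge0.
by rewrite mulr_ge0 ?invr_ge0.
Qed.

End NuclearNorm.

(** * Expectations of i.i.d. coordinates with finitely many values *)

Section FiniteExpectation.
Context {R : realType} (J : finType) (w x : J -> R).
Hypothesis w_ge0 : forall j, 0 <= w j.
Hypothesis w_sum1 : \sum_j w j = 1.

Definition upd (I : eqType) (T : Type) (g : I -> T) (i : I) (t : T) : I -> T :=
  fun k => if k == i then t else g k.

Definition weight (I : finType) (f : {ffun I -> J}) : R := \prod_i w (f i).

Definition expect (I : finType) (F : (I -> R) -> R) : R :=
  \sum_(f : {ffun I -> J}) weight f * F (x \o f).

Lemma weight_ge0 (I : finType) (f : {ffun I -> J}) : 0 <= weight f.
Proof. by apply: prodr_ge0 => i _. Qed.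

Lemma sum_weight (I : finType) : \sum_(f : {ffun I -> J}) weight f = 1.
Proof.
rewrite /weight -(bigA_distr_bigA (fun (_ : I) j => w j)).
by rewrite big1.
Qed.

Lemma eq_expect (I : finType) (F G : (I -> R) -> R) :
  (forall f : {ffun I -> J}, F (x \o f) = G (x \o f)) -> expect F = expect G.
Proof. by move=> FG; apply: eq_bigr => f _; rewrite FG. Qed.

Lemma expect_cst (I : finType) (c : R) : expect (fun _ : I -> R => c) = c.
Proof. by rewrite /expect -mulr_suml sum_weight mul1r. Qed.

Lemma expectZ (I : finType) (c : R) (F : (I -> R) -> R) :
  expect (fun g => c * F g) = c * expect F.
Proof. by rewrite /expect mulr_sumr; apply: eq_bigr => f _; rewrite mulrCA. Qed.

Lemma expectD (I : finType) (F G : (I -> R) -> R) :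
  expect (fun g => F g + G g) = expect F + expect G.
Proof. by rewrite /expect -big_split; apply: eq_bigr => f _; rewrite mulrDr. Qed.

Lemma expect_sum (I : finType) (A : Type) (r : seq A) (P : pred A)
    (F : A -> (I -> R) -> R) :
  expect (fun g => \sum_(a <- r | P a) F a g) = \sum_(a <- r | P a) expect (F a).
Proof.
rewrite /expect exchange_big; apply: eq_bigr => f _.
by rewrite mulr_sumr.
Qed.

Lemma le_expect (I : finType) (F G : (I -> R) -> R) :
  (forall g, F g <= G g) -> expect F <= expect G.
Proof. by move=> FG; apply: ler_sum => f _; rewrite ler_wpM2l ?weight_ge0. Qed.

Lemma expectN (I : finType) (F : (I -> R) -> R) :
  expect (fun g => - F g) = - expect F.
Proof.
by rewrite -mulN1r -expectZ; apply: eq_expect => f; rewrite mulN1r.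
Qed.

Lemma expect_dist_le (I : finType) (F G : (I -> R) -> R) (c : R) :
  (forall g, `|F g - G g| <= c) -> `|expect F - expect G| <= c.
Proof.
move=> FG; rewrite -expectN -expectD -(expect_cst I c).
rewrite (le_trans (ler_norm_sum _ _ _))//; apply: ler_sum => f _.
by rewrite normrM ger0_norm ?weight_ge0// ler_wpM2l ?weight_ge0.
Qed.

(** The conditional expectation given all coordinates but [i]. *)
Definition resample (I : finType) (i : I) (F : (I -> R) -> R) : (I -> R) -> R :=
  fun g => \sum_a w a * F (upd g i (x a)).

Let setf (I : finType) (f : {ffun I -> J}) (i : I) (a : J) : {ffun I -> J} :=
  [ffun k => if k == i then a else f k].

(* Exchanging the resampled value with the old one preserves the weight. *)
Lemma expect_resample (I : finType) (i : I) (F : (I -> R) -> R) :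
  expect (resample i F) = expect F.
Proof.
have W (f : {ffun I -> J}) a : weight (setf f i a) * w (f i) = weight f * w a.
  rewrite /weight (bigD1 i)//= [in RHS](bigD1 i)//= ffunE eqxx.
  rewrite (eq_bigr (fun k => w (f k))); first by ring.
  by move=> k /negbTE ki; rewrite ffunE ki.
have SE (f : {ffun I -> J}) a : x \o setf f i a = upd (x \o f) i (x a).
  by apply/funext => k; rewrite /upd /= ffunE; case: ifP.
pose tau (p : {ffun I -> J} * J) := (setf p.1 i p.2, p.1 i).
have tauK : cancel tau tau.
  move=> [f a]; rewrite /tau /=; congr (_, _); last by rewrite ffunE eqxx.
  by apply/ffunP => k; rewrite !ffunE; case: eqP => [->|].
transitivity (\sum_(p : {ffun I -> J} * J)
    weight p.1 * w p.2 * F (x \o setf p.1 i p.2)).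
  rewrite -(pair_bigA _ (fun f a => weight f * w a * F (x \o setf f i a)))/=.
  apply: eq_bigr => f _; rewrite /resample mulr_sumr.
  by apply: eq_bigr => a _; rewrite mulrA SE.
rewrite (reindex tau)/=; last by exists tau => p _; exact: tauK.
rewrite (eq_bigr (fun p => weight p.1 * w p.2 * F (x \o p.1))); last first.
  move=> p _; rewrite W.
  by rewrite (congr1 fst (tauK p) : setf (setf p.1 i p.2) i (p.1 i) = p.1).
rewrite -(pair_bigA _ (fun f a => weight f * w a * F (x \o f)))/=.
apply: eq_bigr => f _.
by rewrite -mulr_suml -mulr_sumr w_sum1 mulr1.
Qed.

Fixpoint iter_sum (k : nat) (F : (nat -> R) -> R) : R :=
  match k with
  | 0 => F (fun _ => 0)
  | k'.+1 => \sum_a w a * iter_sum k' (fun g => F (upd g k' (x a)))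
  end.

(** Fubini for finite sums: [resample] peels off the coordinate [h k], which by injectivity is not
    read at earlier positions. Positions from [k] on read 0, as in the base case of [iter_sum]. *)
Lemma iter_sum_expect (I : finType) (h : nat -> I) k (F : (nat -> R) -> R) :
  (forall i j, (i < k)%N -> (j < k)%N -> h i = h j -> i = j) ->
  expect (fun g : I -> R => F (fun i => if (i < k)%N then g (h i) else 0))
  = iter_sum k F.
Proof.
elim: k F => [|k ih] F hinj /=; first exact: expect_cst.
rewrite -(expect_resample (h k)) /resample.
rewrite expect_sum; apply: eq_bigr => a _; rewrite expectZ; congr (_ * _).
rewrite -ih; last by move=> i j ik jk; apply: hinj; exact: ltnW.
apply: eq_expect => f; congr F; apply/funext => i; rewrite /upd ltnS leq_eqVlt.
have [->|ik] := eqVneq i k; first by rewrite eqxx.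
rewrite /=; case: ifP => // ik'; rewrite ifF//; apply/negbTE.
by apply: contra ik => /eqP /hinj ->//; exact: ltnW.
Qed.

Definition l1_lipschitz (I : finType) (L : R) (F : (I -> R) -> R) :=
  forall g g', `|F g - F g'| <= L * \sum_i `|g i - g' i|.

Definition plane_rot (I : eqType) (p q : I) (c s : R) (g : I -> R) : I -> R :=
  fun i => if i == p then c * g p + s * g q
           else if i == q then - s * g p + c * g q else g i.

Lemma cos_sin_le1 (c s : R) : c ^+ 2 + s ^+ 2 = 1 -> `|c| <= 1 /\ `|s| <= 1.
Proof.
move=> cs; have H (u v : R) : u ^+ 2 + v ^+ 2 = 1 -> `|u| <= 1.
  move=> uv; rewrite -(@ler_pXn2r _ 2%N) ?nnegrE// real_normK ?num_real// expr1n.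
  by rewrite -uv lerDl sqr_ge0.
by split; [exact: H cs|apply: (H _ c); rewrite addrC].
Qed.

(** Each of the two rotated coordinates may move by the sum of both increments, hence the factor
    2. *)
Lemma lipschitz_rot (I : finType) (L : R) (F : (I -> R) -> R) p q c s :
  0 <= L -> p != q -> c ^+ 2 + s ^+ 2 = 1 -> l1_lipschitz L F ->
  l1_lipschitz (2 * L) (F \o plane_rot p q c s).
Proof.
move=> L0 pq cs LF g g'; rewrite (le_trans (LF _ _))// mulrAC [leRHS]mulrC ler_wpM2l//.
have [c1 s1] := cos_sin_le1 cs.
have qp : q != p by rewrite eq_sym.
rewrite (bigD1 p)//= (bigD1 q)//= [in leRHS](bigD1 p)//= [in leRHS](bigD1 q)//=.
rewrite /plane_rot eqxx (negbTE qp) eqxx.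
rewrite (eq_bigr (fun i => `|g i - g' i|)); last first.
  by move=> i /andP[/negbTE -> /negbTE ->].
set S := \sum_(i | _) _.
have S0 : 0 <= S by rewrite sumr_ge0.
have H (u v a b : R) : `|u| <= 1 -> `|v| <= 1 -> `|u * a + v * b| <= `|a| + `|b|.
  move=> u1 v1; rewrite (le_trans (ler_normD _ _))// !normrM.
  by rewrite lerD// ler_piMl.
have h1 := H c s (g p - g' p) (g q - g' q) c1 s1.
have h2 := H (- s) c (g p - g' p) (g q - g' q).
rewrite normrN in h2; have {}h2 := h2 s1 c1.
rewrite (_ : _ - _ = c * (g p - g' p) + s * (g q - g' q)); last by ring.
rewrite (_ : - s * g p + _ - _ = - s * (g p - g' p) + c * (g q - g' q)); last by ring.
by move: h1 h2; set A := `|_|; set B := `|_|; set C' := `|_|; set D := `|_|; lra.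
Qed.

Section Rotation.
Variable kappa : R.
(** [kappa] measures how far two independent coordinates are from being rotation invariant, as seen
    by Lipschitz functions. *)
Hypothesis rotation_approx : forall (f : R -> R -> R) (L c s : R),
  0 <= L -> (forall u v, 0 <= f u v) ->
  (forall u v u' v', `|f u v - f u' v'| <= L * (`|u - u'| + `|v - v'|)) ->
  0 <= c -> c ^+ 2 + s ^+ 2 = 1 ->
  `|\sum_a w a * (\sum_b w b * f (c * x a + s * x b) (- s * x a + c * x b))
    - \sum_a w a * (\sum_b w b * f (x a) (x b))| <= L * kappa.

(** Resampling [p] and [q] freezes the other coordinates and leaves the planar case. *)
Lemma expect_rot (I : finType) (L : R) (F : (I -> R) -> R) p q c s :
  0 <= L -> p != q -> 0 <= c -> c ^+ 2 + s ^+ 2 = 1 -> l1_lipschitz L F ->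
  (forall g, 0 <= F g) ->
  `|expect (F \o plane_rot p q c s) - expect F| <= L * kappa.
Proof.
move=> L0 pq c0 cs LF F0.
have RR (G : (I -> R) -> R) : expect G =
    expect (fun g => \sum_a w a * \sum_b w b * G (upd (upd g p (x a)) q (x b))).
  by rewrite -(expect_resample q) -(expect_resample p).
rewrite (RR (F \o _)) (RR F); apply: expect_dist_le => g.
have qp : q != p by rewrite eq_sym.
pose f u v := F (upd (upd g p u) q v).
have := @rotation_approx f L c s L0 (fun u v => F0 _).
rewrite /f; under eq_bigr => a _. under eq_bigr => b _.
  rewrite (_ : upd _ _ _ = plane_rot p q c s (upd (upd g p (x a)) q (x b))); last first.
    apply/funext => i; rewrite /upd /plane_rot eqxx (negbTE pq) eqxx.
    have [iq|iq] := eqVneq i q; last by case: eqVneq.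
    by rewrite iq (negbTE qp).
  over. over.
apply => //.
move=> u v u' v'; rewrite (le_trans (LF _ _))// ler_wpM2l//.
rewrite (bigD1 p)//= (bigD1 q)//= /upd !eqxx (negbTE pq) addrA big1 ?addr0//.
by move=> i /andP[/negbTE -> /negbTE ->]; rewrite subrr normr0.
Qed.

Definition plane_rots (I : eqType) (c s : R) (l : seq (I * I)) (g : I -> R) : I -> R :=
  foldr (fun pq h => plane_rot pq.1 pq.2 c s h) g l.

(** Each rotation doubles the Lipschitz constant, so the errors form the geometric series
    [1 + 2 + 4 + ...]. *)
Lemma expect_rots (I : finType) (L : R) (F : (I -> R) -> R) c s l :
  0 <= L -> all (fun pq => pq.1 != pq.2) l -> 0 <= c -> c ^+ 2 + s ^+ 2 = 1 ->
  l1_lipschitz L F -> (forall g, 0 <= F g) ->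
  `|expect (F \o plane_rots c s l) - expect F| <= (2 ^+ size l - 1) * (L * kappa).
Proof.
move=> + + c0 cs; elim: l L F => [|[p q] l ih] L F L0 /=.
  by move=> _ _ _; rewrite expr0 !subrr normr0 mul0r.
move=> /andP[pq al] LF F0.
have h1 := ih (2 * L) (F \o plane_rot p q c s) (mulr_ge0 (ler0n _ 2) L0) al
  (lipschitz_rot L0 pq cs LF) (fun g => F0 _).
have h2 := expect_rot L0 pq c0 cs LF F0.
rewrite -(subrKA (expect (F \o plane_rot p q c s))) (le_trans (ler_normD _ _))//.
rewrite (le_trans (lerD h1 h2))// exprS le_eqVlt; apply/orP; left; apply/eqP.
by ring.
Qed.

End Rotation.

Lemma expect_perm (I : finType) (pi : I -> I) (F : (I -> R) -> R) :
  injective pi -> expect (fun g => F (g \o pi)) = expect F.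
Proof.
move=> pi_inj; pose tau (f : {ffun I -> J}) : {ffun I -> J} := [ffun i => f (pi i)].
have tau_inj : injective tau.
  move=> f f' /ffunP H; apply/ffunP => i.
  by have := H (invF pi_inj i); rewrite !ffunE f_invF.
rewrite [RHS]/expect (reindex_inj tau_inj); apply: eq_bigr => f _.
congr (_ * F _); last by apply/funext => i; rewrite /= ffunE.
rewrite /weight (reindex_inj pi_inj); apply: eq_bigr => i _.
by rewrite ffunE.
Qed.

Section Symmetric.
Variable sg : J -> J.
Hypothesis sgK : involutive sg.
Hypothesis w_sg : forall j, w (sg j) = w j.
Hypothesis x_sg : forall j, x (sg j) = - x j.

(** The involution [sg] realises negation on indices, so changing signs is a reindexing of the
    sum. *)
Lemma expect_sign (I : finType) (e : pred I) (F : (I -> R) -> R) :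
  expect (fun g => F (fun i => (-1) ^+ e i * g i)) = expect F.
Proof.
pose tau (f : {ffun I -> J}) : {ffun I -> J} :=
  [ffun i => if e i then sg (f i) else f i].
have tauK : involutive tau.
  by move=> f; apply/ffunP => i; rewrite !ffunE; case: (e i); rewrite ?sgK.
rewrite [RHS]/expect (reindex_inj (inv_inj tauK)); apply: eq_bigr => f _.
congr (_ * F _); last first.
  apply/funext => i; rewrite /= ffunE; case: ifP => _; rewrite ?expr1 ?expr0 ?mul1r//.
  by rewrite x_sg mulN1r.
by apply: eq_bigr => i _; rewrite ffunE; case: ifP; rewrite ?w_sg.
Qed.

End Symmetric.

End FiniteExpectation.

(** * Invariance of planar Lebesgue integrals under shears and rotations *)

Section LebesgueShears.
Context {R : realType}.
Local Notation mu := (@lebesgue_measure R).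
Local Open Scope ereal_scope.

Lemma measurable_shift (a : R) :
  measurable_fun [set: measurableTypeR R]
    (fun x : measurableTypeR R => (x : R) + a : measurableTypeR R)%R.
Proof. exact: measurable_funD. Qed.

Lemma lebesgue_measure_shift (a : R) (A : set R) : measurable A ->
  pushforward mu
    (fun x : measurableTypeR R => (x : R) + a : measurableTypeR R)%R A = mu A.
Proof.
move=> mA; apply/esym.
apply: (@lebesgue_measure_unique _
  (measure_function_pushforward__canonical__measure_function_Measure mu
    (measurable_shift a))) => //= _ [[b c]] _ <-.
rewrite /pushforward (_ : _ @^-1` _ = `]b - a, c - a]%classic)%R.
  by rewrite !lebesgue_measure_itv/= !lte_fin ltrD2r -!EFinB opprB addrA subrK.
by apply/seteqP; split => x /=; rewrite !in_itv/= ltrBlDr lerBrDr.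
Qed.

Lemma ge0_integral_shift (a : R) (f : R -> \bar R) :
  measurable_fun [set: R] f -> (forall r, 0 <= f r) ->
  \int[mu]_x f (x + a)%R = \int[mu]_x f x.
Proof.
move=> mf f0.
have := ge0_integral_pushforward (measurable_shift a) mu measurableT mf
  (fun y _ => f0 y).
rewrite preimage_setT => <-.
apply: eq_measure_integral => /=; [exact: measurable_shift|move=> ? A mA _].
exact: lebesgue_measure_shift.
Qed.

Lemma ge0_integral_opp (f : R -> \bar R) :
  measurable_fun [set: R] f -> (forall r, 0 <= f r) ->
  \int[mu]_x f (- x)%R = \int[mu]_x f x.
Proof.
move=> mf f0.
have := ge0_integral_pushforward (phi := -%R : measurableTypeR R -> measurableTypeR R)
  (@oppr_measurable R setT) lebesgue_measure measurableT mf
  (fun y _ => f0 y).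
rewrite preimage_setT => <-.
apply: eq_measure_integral => /= A mA _.
exact: lebesgue_measureN.
Qed.

Definition iint (h : R * R -> \bar R) := \int[mu]_x \int[mu]_y h (x, y).

Lemma measurable_shear_x (t : R) :
  measurable_fun [set: R * R] (fun z : R * R => (z.1 + t * z.2, z.2)%R).
Proof.
apply/measurable_fun_pair => //=; apply: measurable_funD => //.
exact: measurable_funM.
Qed.

Lemma measurable_shear_y (t : R) :
  measurable_fun [set: R * R] (fun z : R * R => (z.1, z.2 + t * z.1)%R).
Proof.
apply/measurable_fun_pair => //=; apply: measurable_funD => //.
exact: measurable_funM.
Qed.

Lemma iint_shear_y (t : R) (h : R * R -> \bar R) :
  measurable_fun [set: R * R] h -> (forall z, 0 <= h z) ->
  iint (fun z => h (z.1, z.2 + t * z.1)%R) = iint h.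
Proof.
move=> mh h0; apply: eq_integral => x _ /=.
rewrite (ge0_integral_shift (t * x) (f := fun y => h (x, y)))//.
exact: measurableT_comp mh (measurable_pair1 _).
Qed.

(** Tonelli makes [x] the inner variable, for which the shear is a translation. *)
Lemma iint_shear_x (t : R) (h : R * R -> \bar R) :
  measurable_fun [set: R * R] h -> (forall z, 0 <= h z) ->
  iint (fun z => h (z.1 + t * z.2, z.2)%R) = iint h.
Proof.
move=> mh h0; have mh' := measurableT_comp mh (measurable_shear_x t).
transitivity (\int[mu]_y \int[mu]_x h (x + t * y, y)%R).
  exact (fubini_tonelli (m1 := lebesgue_measure) (m2 := lebesgue_measure) _ mh' (fun z => h0 _)).
transitivity (\int[mu]_y \int[mu]_x h (x, y)); last first.
  exact (esym (fubini_tonelli (m1 := lebesgue_measure) (m2 := lebesgue_measure) _ mh h0)).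
apply: eq_integral => y _ /=.
rewrite (ge0_integral_shift (t * y) (f := fun x => h (x, y)))//.
exact: measurableT_comp mh (measurable_pair2 _).
Qed.

(* A rotation by an angle other than [pi] is a product of three shears. *)
Lemma iint_rotation (c s : R) (h : R * R -> \bar R) :
  (0 <= c)%R -> (c ^+ 2 + s ^+ 2 = 1)%R ->
  measurable_fun [set: R * R] h -> (forall z, 0 <= h z) ->
  iint (fun z => h (c * z.1 + s * z.2, - s * z.1 + c * z.2)%R) = iint h.
Proof.
move=> c0 cs mh h0; have c1 : (1 + c != 0)%R by rewrite gt_eqF// ltr_pwDl.
(* The tangent of half the angle; the shears have parameters [t], [- s], [t]. *)
pose t : R := (s / (1 + c))%R.
have st : (s * t = 1 - c)%R.
  by rewrite /t mulrA; apply: (canLR (mulfK c1)); move: cs; rewrite !expr2; lra.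
have tc : (t * (1 + c) = s)%R by rewrite /t mulfVK.
have mx := measurableT_comp mh (measurable_shear_x t).
have my := measurableT_comp mx (measurable_shear_y (- s)).
have e1 := iint_shear_x t mh h0.
have e2 := iint_shear_y (- s) mx (fun z => h0 _).
have e3 := iint_shear_x t my (fun z => h0 _).
apply: (etrans _ (etrans e3 (etrans e2 e1))).
apply: eq_integral => u _; apply: eq_integral => v _ /=.
congr (h (_, _)).
- rewrite (_ : (_ + _ + _ = (1 - s * t) * u + (t * (1 + 1 - s * t)) * v)%R); last by ring.
  rewrite st (_ : 1 - (1 - c) = c)%R; last by ring.
  by rewrite (_ : 1 + 1 - (1 - c) = 1 + c)%R ?tc//; ring.
- rewrite (_ : (v + _ = - s * u + (1 - s * t) * v)%R); last by ring.
  by rewrite st (_ : 1 - (1 - c) = c)%R//; ring.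
Qed.

End LebesgueShears.

(** * Rotation invariance of the planar Gaussian *)

Section GaussianRotation.
Context {R : realType}.
Local Notation mu := (@lebesgue_measure R).
Local Open Scope ereal_scope.

(** The Radon-Nikodym derivative and the explicit density have the same integral over every
    measurable set, hence agree almost everywhere. *)
Lemma ge0_integral_normal_prob (s : R) (f : R -> \bar R) :
  measurable_fun [set: R] f -> (forall r, 0 <= f r) ->
  \int[normal_prob 0 s]_x f x = \int[mu]_x (f x * (normal_pdf 0 s x)%:E).
Proof.
move=> mf f0; have dom := @normal_prob_dominates R 0 s.
rewrite -(Radon_Nikodym_SigmaFinite.change_of_variables dom)//.
have mpdf : measurable_fun [set: R] (fun x => (normal_pdf 0 s x)%:E).
  by apply/measurable_EFinP; exact: measurable_normal_pdf.
have RNi := Radon_Nikodym_SigmaFinite.f_integrable dom.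
apply: ge0_ae_eq_integral => //.
- by apply: emeasurable_funM => //; exact: measurable_int RNi.
- exact: emeasurable_funM.
- by move=> x _; rewrite mule_ge0// Radon_Nikodym_SigmaFinite.f_ge0.
- by move=> x _; rewrite mule_ge0// lee_fin normal_pdf_ge0.
apply: ae_eqe_mul2l => /=; apply: integral_ae_eq => //.
move=> E _ mE; rewrite -(Radon_Nikodym_SigmaFinite.f_integral dom)//.
Qed.

Lemma ge0_integral_normal_opp (s : R) (f : R -> \bar R) : s != 0%R ->
  measurable_fun [set: R] f -> (forall r, 0 <= f r) ->
  \int[normal_prob 0 s]_x f (- x)%R = \int[normal_prob 0 s]_x f x.
Proof.
move=> s0 mf f0.
rewrite !ge0_integral_normal_prob//; last first.
  exact: measurableT_comp mf (@oppr_measurable R setT).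
rewrite -[RHS]ge0_integral_opp.
- apply: eq_integral => x _; congr (_ * _%:E).
  by rewrite normal_pdfE// /normal_fun !subr0 sqrrN.
- by apply: emeasurable_funM => //; apply/measurable_EFinP; exact: measurable_normal_pdf.
- by move=> x; rewrite mule_ge0// lee_fin normal_pdf_ge0.
Qed.

Lemma lipschitz_continuous (f : R -> R) (L : R) : (0 <= L)%R ->
  (forall u v, `|f u - f v| <= L * `|u - v|)%R -> continuous f.
Proof.
move=> L0 fL u; apply/cvgrPdist_le => e e0; near=> v.
rewrite (le_trans (fL _ _))// (@le_trans _ _ ((L + 1) * `|u - v|)%R)//.
  by rewrite ler_wpM2r// lerDl.
have L1 : (0 < L + 1)%R by rewrite ltr_wpDl.
rewrite mulrC -ler_pdivlMr//; near: v; apply: cvgr_dist_le => //.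
by rewrite divr_gt0// ltr_wpDl.
Unshelve. all: end_near. Qed.

(** [f u v] is the infimum over rational [q] of [f q v + L * |u - q|]: countably many functions,
    each a sum of a function of [v] and a function of [u]. *)
Lemma lipschitz_measurable_pair (f : R -> R -> R) (L : R) : (0 <= L)%R ->
  (forall u v u' v', `|f u v - f u' v'| <= L * (`|u - u'| + `|v - v'|))%R ->
  measurable_fun [set: R * R] (fun z => f z.1 z.2).
Proof.
move=> L0 fL.
have fL2 u v v' : (`|f u v - f u v'| <= L * `|v - v'|)%R.
  by have := fL u v u v'; rewrite subrr normr0 add0r.
pose q (k : nat) : R := ratr (odflt 0%R (unpickle k : option rat)).
pose h k (z : R * R) := (f (q k) z.2 + L * `|z.1 - q k|)%R.
have hlb z k : (f z.1 z.2 <= h k z)%R.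
  have := fL z.1 z.2 (q k) z.2; rewrite subrr normr0 addr0 /h -lerBlDl.
  exact/le_trans/ler_norm.
rewrite (_ : (fun z => _) = (fun z => infs (h ^~ z) 0%N)).
  apply: measurable_fun_infs.
    by move=> z _; exists (f z.1 z.2) => _ [k _ <-]; exact: hlb.
  move=> k; apply: measurable_funD.
    apply: (measurableT_comp (f := f (q k))) => //.
    exact: continuous_measurable_fun (lipschitz_continuous L0 (fL2 _)).
  apply: measurable_funM => //; apply: measurableT_comp => //.
  exact: measurable_funB.
apply/funext => z; apply/eqP; rewrite eq_le; apply/andP; split.
  apply: lb_le_inf; first by exists (h 0%N z), 0%N.
  by move=> _ [k _ <-]; exact: hlb.
apply/ler_addgt0Pr => e e0.
(* Moving from [z.1] to a rational costs [L * e'] twice; the added 1 covers [L = 0]. *)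
pose e' := (e / (2 * L + 1))%R.
have e'0 : (0 < e')%R by rewrite divr_gt0// ltr_pwDr// mulr_ge0.
have /rat_in_itvoo[r] : (z.1 < z.1 + e')%R by rewrite ltrDl.
rewrite in_itv/= => /andP[r1 r2].
apply: (@le_trans _ _ (h (pickle r) z)).
  apply: ge_inf; last by exists (pickle r).
  by exists (f z.1 z.2) => _ [k _ <-]; exact: hlb.
rewrite /h /q pickleK/=.
have zr : (`|z.1 - ratr r| <= e')%R.
  by rewrite distrC ger0_norm ?subr_ge0 ?ltW// ltrBlDl.
have := fL (ratr r) z.2 z.1 z.2; rewrite subrr normr0 addr0 (distrC (ratr r)) => fr.
have Le' : (2 * L * e' <= e)%R.
  rewrite /e' mulrA ler_pdivrMr ?ltr_pwDr ?mulr_ge0// mulrC ler_pM2l//.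
  by rewrite lerDl.
have {}fr := le_trans (ler_norm _) fr.
have {}zr := ler_wpM2l L0 zr.
by lra.
Qed.

(** The product density depends on [x ^+ 2 + y ^+ 2] only; the Lipschitz bound provides joint
    measurability. *)
Lemma ge0_integral_normal_rotation (sd : R) (f : R -> R -> R) (L c s : R) :
  sd != 0%R -> (0 <= L)%R ->
  (forall u v, 0 <= f u v)%R ->
  (forall u v u' v', `|f u v - f u' v'| <= L * (`|u - u'| + `|v - v'|))%R ->
  (0 <= c)%R -> (c ^+ 2 + s ^+ 2 = 1)%R ->
  \int[normal_prob 0 sd]_x \int[normal_prob 0 sd]_y
     (f (c * x + s * y)%R (- s * x + c * y)%R)%:E =
  \int[normal_prob 0 sd]_x \int[normal_prob 0 sd]_y (f x y)%:E.
Proof.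
move=> sd0 L0 f0 fL c0 cs.
have mf := lipschitz_measurable_pair L0 fL.
pose phi := normal_pdf 0 sd.
have mphi : measurable_fun [set: R] phi by exact: measurable_normal_pdf.
have phi0 x : (0 <= phi x)%R by exact: normal_pdf_ge0.
have E (g : R -> R -> R) : (forall u v, 0 <= g u v)%R ->
    measurable_fun [set: R * R] (fun z => g z.1 z.2) ->
    \int[normal_prob 0 sd]_x \int[normal_prob 0 sd]_y (g x y)%:E =
    iint (fun z => (g z.1 z.2 * (phi z.1 * phi z.2))%:E).
  move=> g0 mg; have mgx x : measurable_fun [set: R] (fun y => (g x y)%:E).
    by apply/measurable_EFinP; exact: measurableT_comp mg (pair1_measurable x).
  have mG : measurable_fun [set: R] (fun x => \int[normal_prob 0 sd]_y (g x y)%:E).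
    apply: (measurable_fun_fubini_tonelli_F (m2 := normal_prob 0 sd)
      (fun z => (g z.1 z.2)%:E)).
      exact/measurable_EFinP.
    by move=> z; rewrite lee_fin.
  rewrite ge0_integral_normal_prob//; last first.
    by move=> x; apply: integral_ge0 => y _; rewrite lee_fin.
  apply: eq_integral => x _ /=.
  rewrite (ge0_integral_normal_prob sd (mgx x)); last by move=> y; rewrite lee_fin.
  rewrite -(ge0_integralZr _ measurableT).
  - by apply: eq_integral => y _; rewrite -!EFinM -mulrA [(phi y * _)%R]mulrC.
  - by apply: emeasurable_funM; [exact: mgx|exact/measurable_EFinP].
  - by move=> y _; rewrite mule_ge0// lee_fin.
  - by rewrite lee_fin.
have mrot : measurable_fun [set: R * R]
    (fun z : R * R => (c * z.1 + s * z.2, - s * z.1 + c * z.2)%R).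
  by apply/measurable_fun_pair => //=; apply: measurable_funD => //; exact: measurable_funM.
rewrite (E (fun x y => f (c * x + s * y)%R (- s * x + c * y)%R))//; last first.
  exact: measurableT_comp mf mrot.
rewrite E//.
rewrite -[RHS](iint_rotation c0 cs); first last.
- by move=> z; rewrite lee_fin !mulr_ge0.
- apply/measurable_EFinP; apply: measurable_funM => //.
  by apply: measurable_funM; exact: measurableT_comp.
apply: eq_integral => x _; apply: eq_integral => y _ /=; congr ((_ * _)%:E)%R.
rewrite /phi normal_pdfE// /= /normal_fun !subr0 mulrACA [RHS]mulrACA; congr (_ * _)%R.
rewrite -!expRD; congr expR; rewrite !mulNr -!opprD -!mulrDl; congr (- (_ / _))%R.
rewrite -[LHS]mul1r -cs; ring.
Qed.

End GaussianRotation.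

(** * Integrability and moments of the Gaussian *)

Section GaussianMoments.
Context {R : realType}.
Variable sd : R.
Hypothesis sd_gt0 : 0 < sd.
Local Notation P := (normal_prob 0 sd).

(** The weight turns the density of deviation [sd] into [t / sd] times that of deviation [t]. The
    case [t > sd] gives integrability, the case [t < sd] the second moment. *)
Lemma gauss_exp_moment (t : R) : 0 < t ->
  (\int[P]_x (expR (x ^+ 2 / (sd ^+ 2 *+ 2) - x ^+ 2 / (t ^+ 2 *+ 2)))%:E
   = (t / sd)%:E)%E.
Proof.
move=> t0; have sd0 : sd != 0 by rewrite gt_eqF.
have tn0 : t != 0 by rewrite gt_eqF.
have mexp (a b : R) : measurable_fun [set: R]
    (fun x : R => expR (x ^+ 2 / a - x ^+ 2 / b)).
  apply: measurableT_comp => //; apply: measurable_funB => //;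
  by apply: measurable_funM => //; exact: measurable_funX.
rewrite ge0_integral_normal_prob; last 2 first.
- by apply/measurable_EFinP; exact: mexp.
- by move=> x; rewrite lee_fin expR_ge0.
have peak (u : R) : 0 < u -> normal_peak u = u^-1 * (Num.sqrt (pi *+ 2))^-1.
  move=> u0; rewrite /normal_peak -mulrnAr sqrtrM ?sqr_ge0// invfM.
  by rewrite sqrtr_sqr gtr0_norm.
transitivity (\int[lebesgue_measure]_x ((t / sd)%:E * (normal_pdf 0 t x)%:E))%E.
  apply: eq_integral => x _; rewrite -!EFinM; congr (_%:E).
  rewrite !normal_pdfE// /normal_fun !subr0 mulrCA -expRD !mulNr.
  rewrite addrAC subrr add0r mulrA; congr (_ * _).
  by rewrite !peak//; set k := (Num.sqrt _)^-1; field; rewrite sd0 tn0.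
rewrite ge0_integralZl//; last 3 first.
- by apply/measurable_EFinP; exact: measurable_normal_pdf.
- by move=> x _; rewrite lee_fin normal_pdf_ge0.
- by rewrite lee_fin divr_ge0// ltW.
by rewrite integral_normal_pdf mule1.
Qed.

Lemma integrable_pow4 : P.-integrable [set: R] (EFin \o (fun x : R => 1 + x ^+ 4)).
Proof.
pose t := 2 * sd; have t0 : 0 < t by rewrite mulr_gt0.
pose h (x : R) := expR (x ^+ 2 / (sd ^+ 2 *+ 2) - x ^+ 2 / (t ^+ 2 *+ 2)).
have m4 : measurable_fun [set: R] (fun x : R => 1 + x ^+ 4).
  by apply: measurable_funD => //; exact: measurable_funX.
have mh : measurable_fun [set: R] h.
  apply: measurableT_comp => //; apply: measurable_funB => //;
  by apply: measurable_funM => //; exact: measurable_funX.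
have ih : P.-integrable [set: R] (EFin \o h).
  apply/integrableP; split; first exact/measurable_EFinP.
  under eq_integral do rewrite /= ger0_norm ?expR_ge0//.
  by rewrite gauss_exp_moment// ltry.
(* With [t = 2 * sd] the exponent is [y = 3 * x ^+ 2 / (8 * sd ^+ 2)]. Then [x ^+ 4] is
   [64 / 9 * sd ^+ 4 * y ^+ 2], and [y ^+ 2 <= 4 * expR y] bounds it by
   [256 / 9 * sd ^+ 4 * expR y]. *)
pose K := 1 + 256 * sd ^+ 4.
apply: (le_integrable (T := measurableTypeR R) measurableT (g := EFin \o (fun x => K * h x))) => //.
- exact/measurable_EFinP.
- move=> x _; rewrite /= lee_fin.
  rewrite !ger0_norm ?mulr_ge0 ?expR_ge0 ?addr_ge0 ?exprn_even_ge0//; last first.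
    by rewrite mulr_ge0// exprn_even_ge0.
  have -> : h x = expR (x ^+ 2 * (3 / (8 * sd ^+ 2))).
    by congr expR; rewrite /t; field; rewrite gt_eqF.
  set y := x ^+ 2 * _.
  have y0 : 0 <= y by rewrite mulr_ge0 ?sqr_ge0// divr_ge0// mulr_ge0// sqr_ge0.
  have e1 : 1 <= expR y by rewrite -expR0 ler_expR.
  have e2 : y ^+ 2 <= 4 * expR y.
    have e3 : y / 2 <= expR (y / 2).
      by apply: le_trans (expR_ge1Dx _); rewrite lerDr.
    have : (y / 2) ^+ 2 <= expR (y / 2) ^+ 2 by rewrite ler_pXn2r ?nnegrE// ?expR_ge0// divr_ge0.
    rewrite -expRM_natl (_ : (2%:R * (y / 2)) = y); last by field.
    by rewrite expr_div_n; lra.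
  have xE : x ^+ 4 = 64 / 9 * sd ^+ 4 * y ^+ 2.
    by rewrite /y; field; rewrite gt_eqF.
  have s4 : 0 <= sd ^+ 4 by rewrite exprn_ge0// ltW.
  have e4 := ler_wpM2l s4 e2.
  have e5 : 0 <= sd ^+ 4 * expR y by rewrite mulr_ge0// expR_ge0.
  rewrite xE /K; lra.
- under [X in _.-integrable _ X]eq_fun do rewrite /= EFinM.
  exact: integrableZl.
Qed.

(** A class stable under sums and multiples that contains Lipschitz functions and the moments in
    use, so that integrability comes with membership. *)
Definition dominated (f : R -> R) :=
  measurable_fun [set: R] f /\ exists K, forall x, `|f x| <= K * (1 + x ^+ 4).

Definition gE (f : R -> R) : R := \int[P]_x f x.

Lemma dominated_integrable f : dominated f -> P.-integrable [set: R] (EFin \o f).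
Proof.
move=> [mf [K fK]].
apply: (le_integrable (T := measurableTypeR R) measurableT
  (g := EFin \o (fun x => K * (1 + x ^+ 4)))) => //.
- exact/measurable_EFinP.
- move=> x _; rewrite /= lee_fin (le_trans (fK x))//.
  exact: ler_norm.
- under [X in _.-integrable _ X]eq_fun do rewrite /= EFinM.
  exact: integrableZl measurableT _ _ integrable_pow4.
Qed.

Lemma gE_EFin f : dominated f -> (\int[P]_x (f x)%:E = (gE f)%:E)%E.
Proof.
move=> df; rewrite /gE /Rintegral fineK//.
exact: integrable_fin_num (dominated_integrable df).
Qed.

Lemma dominatedD f g : dominated f -> dominated g -> dominated (fun x => f x + g x).
Proof.
move=> [mf [K fK]] [mg [K' gK]]; split; first exact: measurable_funD.
exists (K + K') => x; rewrite mulrDl (le_trans (ler_normD _ _))//.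
by rewrite lerD.
Qed.

Lemma dominatedZ c f : dominated f -> dominated (fun x => c * f x).
Proof.
move=> [mf [K fK]]; split; first exact: measurable_funM.
by exists (`|c| * K) => x; rewrite normrM -mulrA ler_wpM2l.
Qed.

Lemma dominated_lipschitz f L : 0 <= L ->
  (forall u v, `|f u - f v| <= L * `|u - v|) -> dominated f.
Proof.
move=> L0 fL; split.
  exact: continuous_measurable_fun (lipschitz_continuous L0 fL).
exists (`|f 0| + L) => x.
have x4 : `|x| <= 1 + x ^+ 4.
  have [x1|x1] := leP `|x| 1.
    by rewrite (le_trans x1)// lerDl exprn_even_ge0.
  have -> : x ^+ 4 = `|x| ^+ 4 by rewrite -normrX ger0_norm// exprn_even_ge0.
  by rewrite (@le_trans _ _ (`|x| ^+ 4)) ?lerDr// ler_eXnr// ltW.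
have h1 : 1 <= 1 + x ^+ 4 by rewrite lerDl exprn_even_ge0.
have := fL x 0; rewrite subr0 => h.
have : `|f x| <= `|f 0| + `|f x - f 0|.
  by rewrite -{1}(subrK (f 0) (f x)) addrC ler_normD.
have h2 := ler_wpM2l L0 x4.
have h3 := ler_wpM2l (normr_ge0 (f 0)) h1.
by rewrite mulrDl; lra.
Qed.

Lemma dominated_cst c : dominated (fun=> c).
Proof.
by apply: (@dominated_lipschitz _ 0) => // u v; rewrite subrr normr0 mul0r.
Qed.

Lemma dominated_norm : dominated (fun x => `|x|).
Proof.
apply: (@dominated_lipschitz _ 1) => // u v; rewrite mul1r.
exact: ler_dist_dist.
Qed.

Lemma dominated_pow4 : dominated (fun x => x ^+ 4).
Proof.
split; first exact: measurable_funX.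
exists 1 => x; rewrite mul1r ger0_norm ?exprn_even_ge0// lerDr//.
Qed.

Lemma dominated_sqr : dominated (fun x => x ^+ 2).
Proof.
split; first exact: measurable_funX.
exists 1 => x; rewrite mul1r ger0_norm ?sqr_ge0//.
have -> : x ^+ 4 = (x ^+ 2) ^+ 2 by rewrite -exprM.
have := sqr_ge0 (x ^+ 2 - 1); have := sqr_ge0 (x ^+ 2).
by set y := x ^+ 2; rewrite sqrrB; lra.
Qed.

Lemma gE_cst c : gE (fun=> c) = c.
Proof.
rewrite /gE Rintegral_cst// -[RHS]mulr1; congr (_ * _).
exact: (congr1 fine (integral_normal_pdf 0 sd)).
Qed.

Lemma gED f g : dominated f -> dominated g ->
  gE (fun x => f x + g x) = gE f + gE g.
Proof.
move=> /dominated_integrable df /dominated_integrable dg.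
exact: (RintegralD (T := measurableTypeR R)).
Qed.

Lemma gEZ c f : dominated f -> gE (fun x => c * f x) = c * gE f.
Proof.
by move=> /dominated_integrable df; exact: (RintegralZl (T := measurableTypeR R)).
Qed.

Lemma gE_le f g : dominated f -> dominated g -> (forall x, f x <= g x) ->
  gE f <= gE g.
Proof.
move=> /dominated_integrable df /dominated_integrable dg fg.
by apply: (le_Rintegral (T := measurableTypeR R)).
Qed.

Lemma gE_dist_le f g h : dominated f -> dominated g -> dominated h ->
  (forall x, `|f x - g x| <= h x) -> `|gE f - gE g| <= gE h.
Proof.
move=> df dg dh fgh; rewrite ler_distlC; apply/andP; split.
  rewrite lerBlDr -gED//; apply: gE_le => //; first exact: dominatedD.
  by move=> x; have := fgh x; rewrite ler_distl => /andP[]; lra.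
rewrite -gED//; apply: gE_le => //; first exact: dominatedD.
by move=> x; have := fgh x; rewrite ler_distl => /andP[]; lra.
Qed.

Lemma gE_opp f : dominated f -> (forall x, 0 <= f x) ->
  gE (fun x => f (- x)) = gE f.
Proof.
move=> [mf _] f0; congr fine.
apply: (ge0_integral_normal_opp (f := EFin \o f)).
- by rewrite gt_eqF.
- exact/measurable_EFinP.
- by move=> x; rewrite lee_fin.
Qed.

(* [1 - eta x^2 <= exp (- eta x^2)], integrated against the density, for
   [eta] such that the right-hand side has an explicit Gaussian integral. *)
Lemma second_moment_ge : sd ^+ 2 <= gE (fun x => x ^+ 2).
Proof.
suff H t : 0 < t -> t < sd -> t ^+ 2 <= gE (fun x => x ^+ 2).
  have [//|lt] := leP (sd ^+ 2) (gE (fun x => x ^+ 2)).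
  have m0 : 0 <= gE (fun x => x ^+ 2).
    by rewrite -(gE_cst 0); apply: gE_le => [||x];
      [exact: dominated_cst|exact: dominated_sqr|exact: sqr_ge0].
  set m := gE _ in lt m0 H *.
  have h1 : Num.sqrt m < sd.
    by rewrite -(@ltr_pXn2r _ 2%N) ?nnegrE ?sqrtr_ge0 ?(ltW sd_gt0)// sqr_sqrtr.
  (* The limit [t] to [sd] by contradiction: the midpoint would violate the bound. *)
  pose t := (Num.sqrt m + sd) / 2.
  have h0 := sqrtr_ge0 m.
  have t1 : Num.sqrt m < t by rewrite /t; lra.
  have t2 : t < sd by rewrite /t; lra.
  have t0 : 0 < t by lra.
  have := H t t0 t2; rewrite -[X in _ <= X -> _](sqr_sqrtr m0).
  by rewrite ler_pXn2r ?nnegrE ?(ltW t0)// leNgt t1.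
move=> t0 ts; pose eta := (t ^- 2 - sd ^- 2) / 2.
have eta0 : 0 < eta.
  rewrite /eta divr_gt0// subr_gt0 ltf_pV2 ?posrE ?exprn_gt0//.
  by rewrite ltr_pXn2r// nnegrE ltW.
have sd0 : sd != 0 by rewrite gt_eqF.
have tn0 : t != 0 by rewrite gt_eqF.
have dexp : dominated (fun x => expR (- eta * x ^+ 2)).
  split.
    by apply: measurableT_comp => //; apply: measurable_funM => //; exact: measurable_funX.
  exists 1 => x; rewrite mul1r ger0_norm ?expR_ge0// (@le_trans _ _ 1)//.
    by rewrite -expR0 ler_expR mulNr oppr_le0; apply: mulr_ge0; [exact: ltW|exact: sqr_ge0].
  by rewrite lerDl exprn_even_ge0.
have eE : gE (fun x => expR (- eta * x ^+ 2)) = t / sd.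
  apply: EFin_inj; rewrite -gE_EFin// -gauss_exp_moment//.
  apply: eq_integral => x _; congr (expR _)%:E.
  by rewrite /eta; field; rewrite ?sd0 ?tn0.
have : 1 - eta * gE (fun x => x ^+ 2) <= t / sd.
  rewrite -eE -mulNr -gEZ; last exact: dominated_sqr.
  rewrite -[X in X + _](gE_cst 1) -gED; last 2 first.
  - exact: dominated_cst.
  - by apply: dominatedZ; exact: dominated_sqr.
  apply: gE_le => //.
  - by apply: dominatedD; [exact: dominated_cst|apply: dominatedZ; exact: dominated_sqr].
  - by move=> x; exact: expR_ge1Dx.
rewrite lerBlDl -lerBlDr => h.
rewrite -(ler_pM2l eta0); apply: le_trans h.
(* With [q = t / sd], this is [(1 - q) - (1 - q ^+ 2) / 2 = (1 - q) ^+ 2 / 2]. *)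
rewrite -subr_ge0 (_ : _ - _ = (sd - t) ^+ 2 / (2 * sd ^+ 2)).
  by rewrite divr_ge0 ?sqr_ge0// mulr_ge0// sqr_ge0.
by rewrite /eta; field; rewrite sd0.
Qed.

End GaussianMoments.

(** * Rounding a Gaussian variable towards zero *)

Section GaussianDiscretization.
Context {R : realType}.
Variable sd : R.
Hypothesis sd_gt0 : 0 < sd.
Local Notation gE := (gE sd).

Lemma dominated_sum (I : Type) (r : seq I) (f : I -> R -> R) :
  (forall i, dominated (f i)) -> dominated (fun x => \sum_(i <- r) f i x).
Proof.
move=> df; elim: r => [|i r ih].
  by under eq_fun do rewrite big_nil; exact: dominated_cst.
by under eq_fun do rewrite big_cons; exact: dominatedD.
Qed.

Lemma gE_sum (I : Type) (r : seq I) (f : I -> R -> R) :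
  (forall i, dominated (f i)) ->
  gE (fun x => \sum_(i <- r) f i x) = \sum_(i <- r) gE (f i).
Proof.
move=> df; elim: r => [|i r ih].
  by rewrite big_nil; under eq_fun do rewrite big_nil; exact: gE_cst.
rewrite big_cons -ih -gED//; last exact: dominated_sum.
by under eq_fun do rewrite big_cons.
Qed.

Section Cells.
Variable m : nat.
Hypothesis m_gt0 : (0 < m)%N.

(* Index [j] stands for [j / m <= |x| < (j + 1) / m]; the tail [|x| >= m] is
   sent to the cell of [0]. *)
Definition cell (x : R) : 'I_(m * m).+1 :=
  let k := Num.truncn (m%:R * `|x|) in if (k < m * m)%N then inord k else ord0.

Definition cell_pt (j : 'I_(m * m).+1) : R := j%:R / m%:R.

Let mx_ge0 (x : R) : 0 <= m%:R * `|x|. Proof. by rewrite mulr_ge0. Qed.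

Let mR : 0 < m%:R :> R. Proof. by rewrite ltr0n. Qed.

(** Turns cell membership into comparisons of [m%:R * |x|] with constants, from which measurability
    is read off. *)
Lemma cellE x (j : 'I_(m * m).+1) : (cell x == j) =
  ((j < m * m)%N && ((j%:R <= m%:R * `|x|) && (m%:R * `|x| < j.+1%:R)))
   || ((j == ord0) && ((m * m)%:R <= m%:R * `|x|)).
Proof.
rewrite /cell -truncn_eq// -truncn_ge_nat//.
set k := Num.truncn _; rewrite (leqNgt (m * m) k).
case: ltnP => kN /=; last first.
  rewrite andbT eq_sym; have [->|_] := eqVneq j ord0; first by rewrite orbT.
  rewrite orbF; apply/esym/negbTE; apply/negP => /andP[jN /eqP kj].
  by rewrite kj leqNgt jN in kN.
rewrite andbF orbF -(inj_eq val_inj) /= inordK; last exact: ltnW.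
have [kj|] := eqVneq k j; last by rewrite andbF.
by rewrite -kj kN.
Qed.

Lemma dominated_cell j : dominated (fun x => (cell x == j)%:R).
Proof.
split.
  under eq_fun do rewrite cellE.
  pose b (x : R) := ((j < m * m)%N && ((j%:R <= m%:R * `|x|) && (m%:R * `|x| < j.+1%:R)))
   || ((j == ord0) && ((m * m)%:R <= m%:R * `|x|)).
  have mn : measurable_fun [set: R] (fun x : R => m%:R * `|x|).
    by apply: measurable_funM => //; exact: measurableT_comp.
  have mb : measurable_fun [set: R] b.
    apply: measurable_or.
      apply: measurable_and => //; apply: measurable_and.
        exact: measurable_fun_ler.
      exact: measurable_fun_ltr.
    by apply: measurable_and => //; exact: measurable_fun_ler.
  rewrite (_ : (fun _ => _) = (fun x => if b x then 1 else 0)).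
    exact: measurable_fun_ifT.
  by apply/funext => x; rewrite /b; case: ifP.
exists 1 => x; rewrite mul1r ger0_norm// (@le_trans _ _ 1)//.
  by case: (_ == _).
by rewrite lerDl exprn_even_ge0.
Qed.

Definition cell_weight j : R := gE (fun x => (cell x == j)%:R).

Lemma cell_weight_ge0 j : 0 <= cell_weight j.
Proof.
rewrite -(gE_cst sd 0); apply: (gE_le sd_gt0) => [||x] //; first exact: dominated_cst.
exact: dominated_cell.
Qed.

Lemma cell_sum (c : 'I_(m * m).+1 -> R) x :
  c (cell x) = \sum_j c j * (cell x == j)%:R.
Proof.
rewrite (bigD1 (cell x))//= eqxx mulr1 big1 ?addr0// => j.
by rewrite eq_sym => /negbTE ->; rewrite mulr0.
Qed.

Lemma dominated_comp_cell (c : 'I_(m * m).+1 -> R) :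
  dominated (fun x => c (cell x)).
Proof.
under eq_fun do rewrite cell_sum.
by apply: dominated_sum => j; apply: dominatedZ; exact: dominated_cell.
Qed.

Lemma gE_comp_cell (c : 'I_(m * m).+1 -> R) :
  gE (fun x => c (cell x)) = \sum_j cell_weight j * c j.
Proof.
under eq_fun do rewrite cell_sum.
rewrite gE_sum; last by move=> j; apply: dominatedZ; exact: dominated_cell.
by apply: eq_bigr => j _; rewrite (gEZ sd_gt0 _ (dominated_cell j)) mulrC.
Qed.

Lemma cell_pt_ge0 j : 0 <= cell_pt j.
Proof. by rewrite divr_ge0. Qed.

Lemma cell_cases x : (cell_pt (cell x) <= `|x| < cell_pt (cell x) + m%:R^-1)
  \/ (cell_pt (cell x) = 0 /\ m%:R <= `|x|).
Proof.
rewrite /cell_pt /cell; set k := Num.truncn _; case: ltnP => kN; [left|right].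
  rewrite inordK 1?ltnS 1?ltnW//.
  have /andP[k1 k2] := truncn_itv (mx_ge0 x).
  rewrite ler_pdivrMr// [_ * m%:R]mulrC k1/=.
  by rewrite -[X in _ + X]mul1r -mulrDl ltr_pdivlMr// mulrC natr1.
rewrite mul0r; split => //.
by move: kN; rewrite truncn_ge_nat// natrM ler_pM2l.
Qed.

Lemma cell_pt_le x : cell_pt (cell x) <= `|x|.
Proof. by case: (cell_cases x) => [/andP[]|[->]]. Qed.

(** Within a cell the error is at most [1 / m]; in the tail [m <= |x|] gives [|x| <= x ^+ 2 / m].
    Both integrate to a multiple of [1 / m]. *)
Lemma cell_pt_dist x : `|x| - cell_pt (cell x) <= m%:R^-1 * (1 + x ^+ 2).
Proof.
have m0 : 0 < m%:R^-1 :> R by rewrite invr_gt0.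
case: (cell_cases x) => [/andP[_ h]|[-> h]].
  have := mulr_ge0 (ltW m0) (sqr_ge0 x); lra.
rewrite subr0 -(ler_pM2l mR) mulrA divff ?gt_eqF// mul1r -real_normK ?num_real//.
have := ler_wpM2r (normr_ge0 x) h; rewrite -expr2; lra.
Qed.

(** Within a cell, the difference of squares is at most [1 / m] times [2 * |x|]; in the tail,
    [x ^+ 2 <= x ^+ 4 / m]. *)
Lemma cell_pt_sqr x :
  x ^+ 2 - m%:R^-1 * (2 * `|x| + x ^+ 4) <= cell_pt (cell x) ^+ 2.
Proof.
have m0 : 0 < m%:R^-1 :> R by rewrite invr_gt0.
have x4 : 0 <= x ^+ 4 by rewrite exprn_even_ge0.
have xx : x ^+ 2 = `|x| ^+ 2 by rewrite real_normK ?num_real.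
have := cell_pt_le x; have := cell_pt_ge0 (cell x).
case: (cell_cases x) => [/andP[_ h]|[-> h]] t0 tx.
  set t := cell_pt _ in h t0 tx *; rewrite xx.
  have h1 : (`|x| - t) * (`|x| + t) <= m%:R^-1 * (2 * `|x|).
    by apply: ler_pM; lra.
  have := mulr_ge0 (ltW m0) x4; lra.
rewrite expr0n/= subr_le0.
have h2 : x ^+ 2 <= m%:R^-1 * x ^+ 4.
  rewrite -(ler_pM2l mR) mulVKf ?gt_eqF//.
  have -> : x ^+ 4 = `|x| ^+ 2 * x ^+ 2 by rewrite -xx -exprD.
  apply: ler_wpM2r; first exact: sqr_ge0.
  have m1 : 1 <= m%:R :> R by rewrite ler1n.
  by rewrite (le_trans h)// expr2 ler_peMr// (le_trans m1).
have := mulr_ge0 (ltW m0) (normr_ge0 x); lra.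
Qed.

End Cells.

End GaussianDiscretization.

(** * Finite symmetric laws close to the Gaussian *)

Section GaussianApproximation.
Context {R : realType}.

Definition lip1 (L : R) (f : R -> R) := forall u v, `|f u - f v| <= L * `|u - v|.

(** The relaxation uses the second moment from below and the fourth from above; [K4] is separate
    from [delta] so that the dimension can be fixed first. [approx_card] makes the number of blocks
    exceed the dimension. *)
Record gauss_approx (sd delta K4 : R) (J : finType) (w x : J -> R) (sg : J -> J) :
  Prop := GaussApprox {
  approx_ge0 : forall j, 0 <= w j;
  approx_sum1 : \sum_j w j = 1;
  approx_sgK : involutive sg;
  approx_w_sg : forall j, w (sg j) = w j;
  approx_x_sg : forall j, x (sg j) = - x j;
  approx_card : (1 < #|J|)%N;
  approx_lip : forall (f : R -> R) L, 0 <= L -> (forall u, 0 <= f u) -> lip1 L f ->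
    `|gE sd f - \sum_j w j * f (x j)| <= L * delta;
  approx_moment2 : sd ^+ 2 - delta <= \sum_j w j * x j ^+ 2;
  approx_moment4 : \sum_j w j * x j ^+ 4 <= K4 }.

Variable sd : R.
Hypothesis sd_gt0 : 0 < sd.

(** Rounding towards zero lowers the fourth moment, so the Gaussian one serves for every [delta]. *)
Lemma gauss_approx_exists (delta : R) : 0 < delta ->
  exists (J : finType) (w x : J -> R) (sg : J -> J),
    gauss_approx sd delta (gE sd (fun x => x ^+ 4)) w x sg.
Proof.
move=> delta0.
pose C1 := gE sd (fun x => 1 + x ^+ 2).
pose C2 := gE sd (fun x => 2 * `|x| + x ^+ 4).
have d12 : dominated (fun x : R => 1 + x ^+ 2).
  by apply: dominatedD; [exact: dominated_cst|exact: dominated_sqr].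
have d24 : dominated (fun x : R => 2 * `|x| + x ^+ 4).
  by apply: dominatedD; [apply: dominatedZ; exact: dominated_norm|exact: dominated_pow4].
have [m m0 [m1 m2]] : exists2 m, (0 < m)%N & m%:R^-1 * C1 <= delta /\ m%:R^-1 * C2 <= delta.
  pose b := Num.max C1 C2 / delta.
  have mb : b < (Num.truncn b).+1%:R by exact: truncnS_gt.
  exists (Num.truncn b).+1 => //.
  have h : Num.max C1 C2 <= (Num.truncn b).+1%:R * delta.
    by rewrite -ler_pdivrMr// ltW.
  by split; rewrite mulrC ler_pdivrMr// mulrC (le_trans _ h)// le_max lexx ?orbT.
pose I := 'I_(m * m).+1.
(* Cells see [|x|] only; each is split into two atoms of opposite sign and half the mass. *)
pose w (a : I * bool) : R := cell_weight sd a.1 / 2.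
pose x (a : I * bool) : R := (-1) ^+ a.2 * @cell_pt R m a.1.
pose sg (a : I * bool) := (a.1, ~~ a.2).
have sumE (f : R -> R) : \sum_a w a * f (x a) =
    gE sd (fun u => (f (@cell_pt R m (cell m u)) + f (- @cell_pt R m (cell m u))) / 2).
  rewrite (gE_comp_cell sd_gt0 (fun j => (f (@cell_pt R m j) + f (- @cell_pt R m j)) / 2)).
  rewrite -(pair_bigA _ (fun i b => w (i, b) * f (x (i, b))))/=; apply: eq_bigr => i _.
  by rewrite big_bool /w /x /= expr1 expr0 mulN1r mul1r; field.
have dcell (c : 'I_(m * m).+1 -> R) : dominated (fun u => c (cell m u)).
  exact: dominated_comp_cell.
exists (I * bool)%type, w, x, sg; split.
- by move=> j; rewrite divr_ge0// cell_weight_ge0.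
- have := sumE (fun=> 1); under eq_bigr do rewrite mulr1; move=> ->.
  by rewrite (_ : (1 + 1) / 2 = 1) ?gE_cst//; field.
- by move=> [i b]; rewrite /sg /= negbK.
- by [].
- by move=> [i []]; rewrite /x /= ?expr1 ?expr0 mulN1r ?mul1r ?opprK.
- by rewrite card_prod card_ord card_bool mulSn.
- move=> f L L0 f0 fL; rewrite sumE.
  have df : dominated f by exact: dominated_lipschitz L0 fL.
  have dfN : dominated (fun u => f (- u)).
    apply: (dominated_lipschitz L0) => u v.
    by rewrite (le_trans (fL _ _))// -opprD normrN.
  (* Symmetrising makes the integrand comparable with the two signed atoms of a cell. *)
  have -> : gE sd f = gE sd (fun u => 2^-1 * (f u + f (- u))).
    rewrite gEZ//; last exact: dominatedD.
    by rewrite gED// gE_opp//; field.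
  apply: (@le_trans _ _ (gE sd (fun u => L * (m%:R^-1 * (1 + u ^+ 2))))); last first.
    rewrite (gEZ sd_gt0 _ (dominatedZ _ d12)) (gEZ sd_gt0 _ d12).
    exact: ler_wpM2l.
  apply: (gE_dist_le sd_gt0).
  + exact: (dominatedZ _ (dominatedD df dfN)).
  + exact: (dcell (fun j => (f (@cell_pt R m j) + f (- @cell_pt R m j)) / 2)).
  + exact: (dominatedZ _ (dominatedZ _ d12)).
  + move=> u; set t := cell_pt _.
    have -> : f u + f (- u) = f `|u| + f (- `|u|).
      by case: (ger0P u) => _ //; rewrite opprK addrC.
    have h1 := fL `|u| t; have := fL (- `|u|) (- t).
    rewrite -opprD normrN; move: h1.
    have -> : `| `|u| - t| = `|u| - t by rewrite ger0_norm// subr_ge0 cell_pt_le.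
    have h2 := ler_wpM2l L0 (cell_pt_dist m0 u).
    rewrite !ler_distl => /andP[a1 a2] /andP[a3 a4].
    by apply/andP; split; move: h2; rewrite -/t; lra.
- rewrite (sumE (fun u => u ^+ 2)).
  have dT := dcell (fun j => ((@cell_pt R m j) ^+ 2 + (- @cell_pt R m j) ^+ 2) / 2).
  apply: (@le_trans _ _ (gE sd (fun x => x ^+ 2 + (- m%:R^-1) * (2 * `|x| + x ^+ 4)))).
    rewrite gED//; [|exact: dominated_sqr|exact: dominatedZ].
    by rewrite (gEZ sd_gt0 _ d24) mulNr lerB// second_moment_ge.
  apply: (gE_le sd_gt0) => //.
    by apply: dominatedD; [exact: dominated_sqr|exact: dominatedZ].
  move=> u; have := cell_pt_sqr m0 u; rewrite sqrrN mulNr; lra.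
- rewrite (sumE (fun u => u ^+ 4)).
  have dT := dcell (fun j => ((@cell_pt R m j) ^+ 4 + (- @cell_pt R m j) ^+ 4) / 2).
  apply: (gE_le sd_gt0) => //; first exact: dominated_pow4.
  move=> u; have h : cell_pt (cell m u) ^+ 4 <= u ^+ 4.
    have -> : u ^+ 4 = `|u| ^+ 4 by rewrite -normrX ger0_norm// exprn_even_ge0.
    by rewrite ler_pXn2r// ?nnegrE// ?cell_pt_le// cell_pt_ge0.
  rewrite (_ : (- cell_pt _) ^+ 4 = cell_pt (cell m u) ^+ 4); last by ring.
  by move: h; lra.
Qed.

End GaussianApproximation.

(** * Iterated Gaussian integrals and their finite counterparts *)

Section IteratedGaussian.
Context {R : realType}.
Variable sd : R.
Hypothesis sd_gt0 : 0 < sd.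

Fixpoint giter (k : nat) (F : (nat -> R) -> R) : R :=
  match k with
  | 0 => F (fun _ => 0)
  | k'.+1 => gE sd (fun x => giter k' (fun g => F (upd g k' x)))
  end.

(** Also forces [F] to depend on the first [k] coordinates only. *)
Definition liph (k : nat) (L : R) (F : (nat -> R) -> R) :=
  forall g g', `|F g - F g'| <= L * \sum_(i < k) `|g i - g' i|.

Lemma liph_upd k L F x : liph k.+1 L F -> liph k L (fun g => F (upd g k x)).
Proof.
move=> LF g g'; rewrite (le_trans (LF _ _))// big_ord_recr/= /upd eqxx subrr.
rewrite normr0 addr0 le_eqVlt; apply/orP; left; apply/eqP; congr (_ * _).
by apply: eq_bigr => i _; rewrite ltn_eqF.
Qed.

Lemma liph_upd_dist k L F x y g : liph k.+1 L F ->
  `|F (upd g k x) - F (upd g k y)| <= L * `|x - y|.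
Proof.
move=> LF; rewrite (le_trans (LF _ _))// big_ord_recr/= /upd eqxx big1 ?add0r//.
by move=> i _; rewrite ltn_eqF// subrr normr0.
Qed.

(** The induction hypothesis, applied to two values of the last coordinate, shows that the inner
    integral is Lipschitz, hence measurable and integrable. *)
Lemma giter_dist k L F G c : 0 <= L -> liph k L F -> liph k L G ->
  (forall g, `|F g - G g| <= c) -> `|giter k F - giter k G| <= c.
Proof.
elim: k F G c => [|k ih] F G c L0 LF LG FG /=; first exact: FG.
have dom H : liph k.+1 L H -> dominated (fun x => giter k (fun g => H (upd g k x))).
  move=> LH; apply: (dominated_lipschitz L0) => u v.
  apply: ih => //; [exact: liph_upd|exact: liph_upd|move=> g].
  exact: liph_upd_dist.
rewrite -(gE_cst sd c); apply: (gE_dist_le sd_gt0).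
- exact: dom.
- exact: dom.
- exact: dominated_cst.
- by move=> x; apply: ih => //; exact: liph_upd.
Qed.

Lemma giter_lip k L F : 0 <= L -> liph k.+1 L F ->
  lip1 L (fun x => giter k (fun g => F (upd g k x))).
Proof.
move=> L0 LF u v.
apply: (giter_dist L0); [exact: liph_upd|exact: liph_upd|move=> g].
exact: liph_upd_dist.
Qed.

Lemma gE_ge0 f : dominated f -> (forall x, 0 <= f x) -> 0 <= gE sd f.
Proof.
by move=> df f0; rewrite -(gE_cst sd 0); apply: (gE_le sd_gt0) => //; exact: dominated_cst.
Qed.

Lemma giter_ge0 k L F : 0 <= L -> liph k L F -> (forall g, 0 <= F g) ->
  0 <= giter k F.
Proof.
elim: k F => [|k ih] F L0 LF F0 /=; first exact: F0.
apply: gE_ge0; first exact: (dominated_lipschitz L0 (giter_lip L0 LF)).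
by move=> x; apply: ih => //; exact: liph_upd.
Qed.

Lemma gauss_iter_giter k L F : 0 <= L -> liph k L F ->
  gauss_iter sd k (fun g => (F g)%:E) = (giter k F)%:E.
Proof.
elim: k F => [//|k ih] F L0 LF /=.
rewrite -gE_EFin//; last exact: (dominated_lipschitz L0 (giter_lip L0 LF)).
apply: eq_integral => x _; rewrite -(ih (fun g => F (upd g k x)))//.
exact: liph_upd.
Qed.

Section Approx.
Variables (delta K4 : R) (J : finType) (w x : J -> R) (sg : J -> J).
Hypothesis wx : gauss_approx sd delta K4 w x sg.

(** Replacement of one coordinate at a time, at the cost [L * delta] each. *)
Lemma giter_iter_sum k L F : 0 <= L -> liph k L F -> (forall g, 0 <= F g) ->
  `|giter k F - iter_sum w x k F| <= k%:R * (L * delta).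
Proof.
elim: k F => [|k ih] F L0 LF F0 /=; first by rewrite subrr normr0 mul0r.
set phi := fun u => giter k _.
have lphi : lip1 L phi := giter_lip L0 LF.
have phi0 u : 0 <= phi u by apply: (giter_ge0 L0 (liph_upd u LF)).
have h1 := approx_lip wx L0 phi0 lphi.
have h2 : `|\sum_j w j * phi (x j)
    - \sum_j w j * iter_sum w x k (fun g => F (upd g k (x j)))| <= k%:R * (L * delta).
  rewrite -sumrB; apply: (@le_trans _ _ (\sum_j w j * (k%:R * (L * delta)))).
    rewrite (le_trans (ler_norm_sum _ _ _))//; apply: ler_sum => j _.
    rewrite -mulrBr normrM ger0_norm ?(approx_ge0 wx)// ler_wpM2l ?(approx_ge0 wx)//.
    by apply: ih => //; exact: liph_upd.
  by rewrite -mulr_suml (approx_sum1 wx) mul1r.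
rewrite -(subrKA (\sum_j w j * phi (x j))) (le_trans (ler_normD _ _))//.
by rewrite (le_trans (lerD h1 h2))// -natr1 mulrDl mul1r addrC.
Qed.

Definition lip2 (L : R) (f : R -> R -> R) :=
  forall u v u' v', `|f u v - f u' v'| <= L * (`|u - u'| + `|v - v'|).

Let gE2 (f : R -> R -> R) := gE sd (fun u => gE sd (f u)).

Let lip2l L f u : lip2 L f -> lip1 L (f u).
Proof. by move=> Lf v v'; have := Lf u v u v'; rewrite subrr normr0 add0r. Qed.

Let lip2_gE L f : 0 <= L -> lip2 L f -> lip1 L (fun u => gE sd (f u)).
Proof.
move=> L0 Lf u u'; rewrite -(gE_cst sd (L * _)); apply: (gE_dist_le sd_gt0).
- exact: dominated_lipschitz L0 (lip2l u Lf).
- exact: dominated_lipschitz L0 (lip2l u' Lf).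
- exact: dominated_cst.
- by move=> v; have := Lf u v u' v; rewrite subrr normr0 addr0.
Qed.

Let gE2_sum L f : 0 <= L -> lip2 L f -> (forall u v, 0 <= f u v) ->
  `|gE2 f - \sum_a w a * (\sum_b w b * f (x a) (x b))| <= 2 * (L * delta).
Proof.
move=> L0 Lf f0.
have dom u : dominated (f u) := dominated_lipschitz L0 (lip2l u Lf).
have h1 := approx_lip wx L0 (fun u => gE_ge0 (dom u) (f0 u)) (lip2_gE L0 Lf).
have h2 : `|\sum_a w a * gE sd (f (x a))
    - \sum_a w a * (\sum_b w b * f (x a) (x b))| <= L * delta.
  rewrite -sumrB; apply: (@le_trans _ _ (\sum_j w j * (L * delta))).
    rewrite (le_trans (ler_norm_sum _ _ _))//; apply: ler_sum => j _.
    rewrite -mulrBr normrM ger0_norm ?(approx_ge0 wx)// ler_wpM2l ?(approx_ge0 wx)//.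
    exact: (approx_lip wx L0 (f0 _) (lip2l _ Lf)).
  by rewrite -mulr_suml (approx_sum1 wx) mul1r.
rewrite -(subrKA (\sum_a w a * gE sd (f (x a)))) (le_trans (ler_normD _ _))//.
by rewrite (le_trans (lerD h1 h2))// mulr_natl mulr2n.
Qed.

Let gE2_EFin L f : 0 <= L -> lip2 L f ->
  (\int[normal_prob 0 sd]_u \int[normal_prob 0 sd]_v (f u v)%:E = (gE2 f)%:E)%E.
Proof.
move=> L0 Lf; rewrite /gE2 -gE_EFin//; last first.
  exact: dominated_lipschitz L0 (lip2_gE L0 Lf).
apply: eq_integral => u _; rewrite gE_EFin//.
exact: dominated_lipschitz L0 (lip2l u Lf).
Qed.

(** Pass to the Gaussian, rotate exactly, and pass back. Two coordinates are replaced each time,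
    with constant [2 * L] for the rotated function and [L] for [f]: [4 + 2 = 6]. *)
Lemma gauss_approx_rotation (f : R -> R -> R) (L c s : R) :
  0 <= L -> (forall u v, 0 <= f u v) -> lip2 L f ->
  0 <= c -> c ^+ 2 + s ^+ 2 = 1 ->
  `|\sum_a w a * (\sum_b w b * f (c * x a + s * x b) (- s * x a + c * x b))
    - \sum_a w a * (\sum_b w b * f (x a) (x b))| <= L * (6 * delta).
Proof.
move=> L0 f0 Lf c0 cs.
pose fr u v := f (c * u + s * v) (- s * u + c * v).
have L2 : 0 <= 2 * L by rewrite mulr_ge0.
have Lfr : lip2 (2 * L) fr.
  move=> u v u' v'; rewrite (le_trans (Lf _ _ _ _))// mulrAC [leRHS]mulrC ler_wpM2l//.
  have [c1 s1] := cos_sin_le1 cs.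
  have H (p q a b : R) : `|p| <= 1 -> `|q| <= 1 -> `|p * a + q * b| <= `|a| + `|b|.
    move=> p1 q1; rewrite (le_trans (ler_normD _ _))// !normrM.
    by rewrite lerD// ler_piMl.
  have h1 := H c s (u - u') (v - v') c1 s1.
  have h2 := H (- s) c (u - u') (v - v').
  rewrite normrN in h2; have {}h2 := h2 s1 c1.
  rewrite (_ : _ - _ = c * (u - u') + s * (v - v')); last by ring.
  rewrite (_ : - s * u + _ - _ = - s * (u - u') + c * (v - v')); last by ring.
  lra.
have E : gE2 fr = gE2 f.
  apply: EFin_inj; rewrite -(gE2_EFin L2 Lfr) -(gE2_EFin L0 Lf).
  by apply: (ge0_integral_normal_rotation _ L0 f0 Lf c0 cs); rewrite gt_eqF.
have h1 := gE2_sum L2 Lfr (fun u v => f0 _ _).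
have h2 := gE2_sum L0 Lf f0.
rewrite E distrC in h1.
rewrite -(subrKA (gE2 f)) (le_trans (ler_normD _ _))//.
rewrite (le_trans (lerD h1 h2))// le_eqVlt; apply/orP; left; apply/eqP.
by ring.
Qed.

End Approx.
End IteratedGaussian.

(** * Triangularisation by plane rotations *)

Section RowElimination.
Context {R : realType}.

Definition mxof m n (g : 'I_m * 'I_n -> R) : 'M[R]_(m, n) := \matrix_(i, j) g (i, j).

Definition fro2 m n (Y : 'M[R]_(m, n)) : R := \sum_i \sum_j Y i j ^+ 2.
Definition fro m n (Y : 'M[R]_(m, n)) : R := Num.sqrt (fro2 Y).

Lemma fro2_ge0 m n (Y : 'M[R]_(m, n)) : 0 <= fro2 Y.
Proof. by apply: sumr_ge0 => i _; apply: sumr_ge0 => j _; exact: sqr_ge0. Qed.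

Lemma fro_ge0 m n (Y : 'M[R]_(m, n)) : 0 <= fro Y.
Proof. exact: sqrtr_ge0. Qed.

Lemma sqr_fro m n (Y : 'M[R]_(m, n)) : fro Y ^+ 2 = fro2 Y.
Proof. by rewrite sqr_sqrtr// fro2_ge0. Qed.

Lemma fro2_trace m n (Y : 'M[R]_(m, n)) : fro2 Y = \tr (Y^T *m Y).
Proof.
rewrite mxtrace_mul; apply: eq_bigr => i _; apply: eq_bigr => j _.
by rewrite expr2.
Qed.

Lemma entry_le_fro m n (Y : 'M[R]_(m, n)) i j : `|Y i j| <= fro Y.
Proof.
rewrite -(@ler_pXn2r _ 2%N) ?nnegrE ?fro_ge0// real_normK ?num_real// sqr_fro.
rewrite /fro2 (bigD1 i)//= (bigD1 j)//= -addrA lerDl addr_ge0//.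
  by apply: sumr_ge0 => k _; exact: sqr_ge0.
by apply: sumr_ge0 => k _; apply: sumr_ge0 => l _; exact: sqr_ge0.
Qed.

Lemma fro2_orthogonal_mul m n (Q : 'M[R]_m) (Y : 'M[R]_(m, n)) :
  orthogonal Q -> fro2 (Q *m Y) = fro2 Y.
Proof.
move=> oQ; rewrite !fro2_trace trmx_mul mulmxA -(mulmxA Y^T).
by rewrite orthogonal_tr// mulmx1.
Qed.

(** An entry of [g] enters [d] entries of the product, with coefficients bounded by [fro Y]. *)
Lemma lipschitz_nuc_mul d n (Y : 'M[R]_(n, d)) :
  l1_lipschitz (d%:R * fro Y) (fun g : 'I_d * 'I_n -> R => nuc (mxof g *m Y)).
Proof.
move=> g g'; rewrite (le_trans (nuc_lipschitz _ _))//.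
rewrite (eq_bigr (fun p : 'I_d * 'I_n => `|g (p.1, p.2) - g' (p.1, p.2)|)); last by case.
rewrite -(pair_bigA _ (fun i k => `|g (i, k) - g' (i, k)|))/= mulr_sumr.
apply: ler_sum => i _.
apply: (@le_trans _ _ (\sum_(j < d) \sum_(k < n) `|g (i, k) - g' (i, k)| * fro Y)).
  apply: ler_sum => j _; rewrite !mxE -sumrB (le_trans (ler_norm_sum _ _ _))//.
  apply: ler_sum => k _; rewrite !mxE -mulrBl normrM ler_wpM2l//.
  exact: entry_le_fro.
by rewrite sumr_const card_ord -mulr_suml -[leLHS]mulr_natl mulrA mulrAC.
Qed.

Lemma givens_tr n (p q : 'I_n) (c s : R) : p != q ->
  (givens p q c s)^T = givens p q c (- s).
Proof.
move=> pq; have qp : (q == p) = false by rewrite eq_sym (negbTE pq).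
have E (x y : 'I_n) : (x == y) = (y == x) by rewrite eq_sym.
apply/matrixP => i j; rewrite !mxE.
have [ip|ip] := boolP (i == p); have [iq|iq] := boolP (i == q);
have [jp|jp] := boolP (j == p); have [jq|jq] := boolP (j == q);
  try (by move: pq; rewrite -(eqP ip) (eqP iq) eqxx);
  try (by move: pq; rewrite -(eqP jp) (eqP jq) eqxx);
  try rewrite (eqP ip); try rewrite (eqP iq);
  try rewrite (eqP jp); try rewrite (eqP jq);
  rewrite ?eqxx ?(negbTE pq) ?qp ?(negbTE ip) ?(negbTE iq) ?(negbTE jp) ?(negbTE jq)
    ?[p == j]E ?[q == j]E ?[p == i]E ?[q == i]E
    ?(negbTE ip) ?(negbTE iq) ?(negbTE jp) ?(negbTE jq) /=; try ring.
by rewrite E.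
Qed.

Lemma zeroing_rotation (a b : R) :
  exists c s, [/\ 0 <= c, c ^+ 2 + s ^+ 2 = 1 & - s * a + c * b = 0].
Proof.
pose r2 := a ^+ 2 + b ^+ 2.
have [r0|r0] := eqVneq r2 0.
  have a0 : a = 0.
    apply/eqP; rewrite -sqrf_eq0 eq_le sqr_ge0 andbT -r0 lerDl; exact: sqr_ge0.
  have b0 : b = 0.
    apply/eqP; rewrite -sqrf_eq0 eq_le sqr_ge0 andbT -r0 lerDr; exact: sqr_ge0.
  by exists 1, 0; split; rewrite ?a0 ?b0 ?expr0n/= ?expr1n ?addr0 ?mulr0 ?addr0.
have r2p : 0 < r2 by rewrite lt_def r0 addr_ge0 ?sqr_ge0.
pose r := Num.sqrt r2.
have rp : 0 < r by rewrite sqrtr_gt0.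
have rr : r ^+ 2 = r2 by rewrite sqr_sqrtr// ltW.
have rn0 : r != 0 by rewrite gt_eqF.
have H u v : u ^+ 2 + v ^+ 2 = r2 -> (u / r) ^+ 2 + (v / r) ^+ 2 = 1.
  by move=> uv; rewrite !expr_div_n -mulrDl uv rr divff.
(* Both [(c, s)] and its negative clear the entry; the sign of [a] selects the one with [0 <= c]. *)
have [a0|a0] := leP 0 a.
  exists (a / r), (b / r); split; [by rewrite divr_ge0// ltW|exact: H|by field].
exists (- a / r), (- b / r); split.
- by rewrite divr_ge0 ?ltW// oppr_gt0.
- by apply: H; rewrite !sqrrN.
- by field.
Qed.

(** At most one rotation per entry. Rotations preserve [fro2], so the change of [Phi] is only
    assumed small for matrices of the norm of [Y], and one [e] serves for all steps. *)
Lemma givens_elimination n d (Y : 'M[R]_(n, d)) (Phi : 'M[R]_(n, d) -> R) (e : R) :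
  0 <= e ->
  (forall Z p q c s, p != q -> 0 <= c -> c ^+ 2 + s ^+ 2 = 1 -> fro2 Z = fro2 Y ->
     `|Phi (givens p q c s *m Z) - Phi Z| <= e) ->
  exists Z, [/\ fro2 Z = fro2 Y, forall (i : 'I_n) (j : 'I_d), (j < i)%N -> Z i j = 0 &
    `|Phi Y - Phi Z| <= (d * n)%:R * e].
Proof.
move=> e0 Phie.
(* Invariant in column-major order: below the diagonal, columns before [j] are cleared, and column
   [j] in the rows before [k]. *)
pose done (j k : nat) (Z : 'M[R]_(n, d)) := forall (i : 'I_n) (j' : 'I_d),
  (j' < i)%N -> (j' < j)%N || ((j' == j :> nat) && (i < k)%N) -> Z i j' = 0.
pose P j k := exists Z, [/\ fro2 Z = fro2 Y, done j k Z &
   `|Phi Y - Phi Z| <= (j * n + k)%:R * e].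
have P00 : P 0%N 0%N.
  by exists Y; split => //; [move=> i j' _; rewrite andbF|rewrite subrr normr0 mul0r].
have PS j k : (j < d)%N -> (k < n)%N -> P j k -> P j k.+1.
  move=> jd kn [Z [Z1 Z2 Z3]].
  have [kj|jk] := leqP k j.
    exists Z; split => //; last first.
      by rewrite (le_trans Z3)// ler_wpM2r// ler_nat addnS.
    move=> i j' ji H; apply: Z2 => //; case/orP: H => [->//|/andP[/eqP jj ik]].
    by move: ji; rewrite jj => ji; have := leq_trans ji (ik : (i <= k)%N); rewrite ltnNge kj.
  (* The pivot is row [j]. Both rows vanish in the columns before [j], so these stay cleared. *)
  pose p := Ordinal (ltn_trans jk kn); pose q := Ordinal kn.
  have pq : p != q by rewrite -(inj_eq val_inj)/= ltn_eqF.
  have [c [s [c0 cs cs0]]] := zeroing_rotation (Z p (Ordinal jd)) (Z q (Ordinal jd)).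
  exists (givens p q c s *m Z); split.
  - by rewrite fro2_orthogonal_mul//; exact: givens_orthogonal.
  - move=> i j' ji H; rewrite givens_mul//.
    case: (eqVneq i p) => [ip|ip].
      subst i; have jj : (j' < j)%N by exact: ji.
      by rewrite !Z2 ?jj//= ?mulr0 ?addr0// (ltn_trans jj).
    case: (eqVneq i q) => [iq|iq].
      subst i; case/orP: H => [jj|/andP[/eqP jj _]].
        by rewrite !Z2 ?jj//= ?mulr0 ?addr0// (ltn_trans jj).
      by rewrite (_ : j' = Ordinal jd)//; exact/val_inj.
    apply: Z2 => //; case/orP: H => [->//|/andP[-> ik]]; apply/orP; right.
    rewrite /= ltn_neqAle -ltnS ik andbT; apply: contra iq => /eqP ik'.
    exact/eqP/val_inj.
  - rewrite -(subrKA (Phi Z)) (le_trans (ler_normD _ _))// addnS -natr1 mulrDl mul1r.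
    by rewrite lerD// distrC; exact: Phie.
have Pn j : (j < d)%N -> P j 0%N -> P j n.
  move=> jd P0; have : forall k, (k <= n)%N -> P j k; last by apply.
  by elim=> [//|k ih kn]; apply: PS => //; apply: ih; exact: ltnW.
have Pd j : (j <= d)%N -> P j 0%N.
  elim: j => [//|j ih jd]; have [Z [Z1 Z2 Z3]] := Pn j jd (ih (ltnW jd)).
  exists Z; split => //; last by rewrite addn0 mulSn addnC.
  move=> i j' ji; rewrite andbF orbF ltnS leq_eqVlt => H; apply: Z2 => //.
  by rewrite orbC ltn_ord andbT.
have [Z [Z1 Z2 Z3]] := Pd d (leqnn d); exists Z; split => //.
  by move=> i j ji; apply: Z2 => //; rewrite ltn_ord.
by rewrite addn0 in Z3.
Qed.

Lemma rots_rowE d n (p q : 'I_n) (c s : R) (l : seq 'I_d) (g : 'I_d * 'I_n -> R) i k :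
  p != q -> uniq l ->
  plane_rots c s [seq ((a, p), (a, q)) | a <- l] g (i, k) =
  if i \in l then plane_rot p q c s (fun k' => g (i, k')) k else g (i, k).
Proof.
move=> pq; elim: l i k => [//|a l ih] i k /= /andP[al ul].
rewrite /plane_rot /= !xpair_eqE inE !ih// (negbTE al).
have [->|ia] := eqVneq i a; first by rewrite (negbTE al) /= /plane_rot.
by [].
Qed.

(** A rotation of two columns is one planar rotation per row, on disjoint pairs of coordinates. *)
Lemma mxof_rots d n (p q : 'I_n) (c s : R) (g : 'I_d * 'I_n -> R) : p != q ->
  mxof (plane_rots c s [seq ((a, p), (a, q)) | a <- enum 'I_d] g) =
  mxof g *m (givens p q c s)^T.
Proof.
move=> pq; apply/matrixP => i k; rewrite mxE rots_rowE ?enum_uniq// mem_enum.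
have -> : (mxof g *m (givens p q c s)^T) i k = (givens p q c s *m (mxof g)^T) k i.
  by rewrite -[in RHS](trmxK (givens _ _ _ _)) -trmx_mul [RHS]mxE.
by rewrite givens_mul// !mxE.
Qed.

End RowElimination.

(** * Averaging over signed cyclic shifts, and reduction to square matrices *)

Section SignedShiftAverage.
Context {R : realType}.

(** Flipping the sign at [k] negates the cross terms of [k] with any other index. *)
Lemma rademacher_sqr n (a : 'I_n -> R) :
  \sum_(e : {ffun 'I_n -> bool}) (\sum_k (-1) ^+ e k * a k) ^+ 2 =
  2 ^+ n * \sum_k a k ^+ 2.
Proof.
have cross k l : k != l ->
    \sum_(e : {ffun 'I_n -> bool}) (-1) ^+ e k * (-1) ^+ e l = 0 :> R.
  move=> kl; pose flip (e : {ffun 'I_n -> bool}) := [ffun i => (i == k) (+) e i].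
  have flipK : involutive flip.
    by move=> e; apply/ffunP => i; rewrite !ffunE addbA addbb.
  set S := \sum_e _; have : S = - S.
    rewrite {1}/S (reindex_inj (inv_inj flipK)) -sumrN; apply: eq_bigr => e _.
    rewrite !ffunE eqxx [l == k]eq_sym (negbTE kl) /=.
    by case: (e k); rewrite /= ?expr1 ?expr0; ring.
  by move=> h; lra.
have diag k : \sum_(e : {ffun 'I_n -> bool}) (-1) ^+ e k * (-1) ^+ e k = 2 ^+ n :> R.
  under eq_bigr do rewrite -expr2 sqrr_sign.
  by rewrite sumr_const card_ffun card_bool card_ord natrX.
transitivity (\sum_k \sum_l a k * a l *
    \sum_(e : {ffun 'I_n -> bool}) (-1) ^+ e k * (-1) ^+ e l).
  under eq_bigr => e _.
    rewrite expr2 big_distrlr /=.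
    over.
  rewrite exchange_big; apply: eq_bigr => k _.
  rewrite exchange_big; apply: eq_bigr => l _.
  by rewrite mulr_sumr; apply: eq_bigr => e _; ring.
rewrite mulr_sumr; apply: eq_bigr => k _.
rewrite (bigD1 k)//= diag big1 ?addr0; first by ring.
by move=> l lk; rewrite cross ?mulr0// eq_sym.
Qed.

(** [k + c] is addition modulo [d.+1]. *)
Definition signed_shift d (T : 'M[R]_d.+1) (e : {ffun 'I_d.+1 -> bool}) (c : 'I_d.+1) :
  'M[R]_d.+1 := \matrix_(k, j) ((-1) ^+ e k * T (k + c) j).

(** Signs remove the cross terms, and the shifts bring every row of [T] against every coordinate of
    [v]. *)
Lemma signed_shift_average d (T : 'M[R]_d.+1) (v : 'cV[R]_d.+1) :
  \sum_(e : {ffun 'I_d.+1 -> bool}) \sum_c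
    \sum_j ((signed_shift T e c)^T *m v) j 0 ^+ 2 =
  2 ^+ d.+1 * (fro2 T * \sum_k v k 0 ^+ 2).
Proof.
rewrite exchange_big /=.
transitivity (\sum_c \sum_j 2 ^+ d.+1 * \sum_k (T (k + c) j * v k 0) ^+ 2).
  apply: eq_bigr => c _; rewrite exchange_big /=; apply: eq_bigr => j _.
  rewrite -rademacher_sqr; apply: eq_bigr => e _; congr (_ ^+ 2).
  by rewrite mxE; apply: eq_bigr => k _; rewrite !mxE mulrA.
rewrite (eq_bigr (fun c => 2 ^+ d.+1 * \sum_j \sum_k (T (k + c) j * v k 0) ^+ 2)); last first.
  by move=> c _; rewrite mulr_sumr.
rewrite -mulr_sumr; congr (_ * _); rewrite mulr_sumr.
transitivity (\sum_k \sum_c \sum_j (T (k + c) j * v k 0) ^+ 2).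
  under eq_bigr do rewrite exchange_big /=.
  by rewrite exchange_big.
apply: eq_bigr => k _; rewrite /fro2 [in RHS](reindex_inj (addrI k)) /= mulr_suml.
by apply: eq_bigr => c _; rewrite mulr_suml; apply: eq_bigr => j _; rewrite exprMn.
Qed.

(* Choosing optimal [O_P] for every signed shift [P T], the matrix
   [B = \sum_P O_P (P T)^T] satisfies [|B v|^2 <= N^2 |T|^2 |v|^2 / d], because
   the average of [P T T^T P^T] is scalar. *)
Lemma sum_nuc_signed_shift d (V T : 'M[R]_d.+1) :
  \sum_(e : {ffun 'I_d.+1 -> bool}) \sum_c nuc (V *m signed_shift T e c) <=
  (2 ^+ d.+1 * d.+1%:R) * (fro T / Num.sqrt d.+1%:R) * nuc V.
Proof.
have att e c : exists Q : 'M[R]_d.+1, orthogonal Q /\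
    nuc (V *m signed_shift T e c) = \tr (V^T *m (Q *m (signed_shift T e c)^T)).
  have [Q oQ ->] := nuc_attained (V *m signed_shift T e c); exists Q; split => //.
  by rewrite trmx_mul -mulmxA mxtrace_mulC mulmxA.
pose Q e c := projT1 (cid (att e c)).
have oQ e c : orthogonal (Q e c) by rewrite /Q; case: cid => ? [].
have nQ e c : nuc (V *m signed_shift T e c) =
    \tr (V^T *m (Q e c *m (signed_shift T e c)^T)).
  by rewrite /Q; case: cid => ? [].
pose A : finType := ({ffun 'I_d.+1 -> bool} * 'I_d.+1)%type.
pose M (p : A) := Q p.1 p.2 *m (signed_shift T p.1 p.2)^T.
have cardA : #|A|%:R = 2 ^+ d.+1 * d.+1%:R :> R.
  by rewrite card_prod card_ffun card_bool card_ord natrM natrX.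
have -> : \sum_e \sum_c nuc (V *m signed_shift T e c) = \tr (V^T *m \sum_p M p).
  rewrite pair_bigA /= mulmx_sumr raddf_sum /=.
  by apply: eq_bigr => p _; rewrite nQ.
have s0 : 0 < Num.sqrt d.+1%:R :> R by rewrite sqrtr_gt0 ltr0n.
have d0 : 0 < d.+1%:R :> R by rewrite ltr0n.
rewrite -cardA; apply: mxtrace_le_nuc.
  by rewrite mulr_ge0// divr_ge0 ?fro_ge0// ltW.
move=> v.
(* Cauchy-Schwarz over the signed shifts; afterwards the orthogonal factors drop out of the
   lengths. *)
apply: (@le_trans _ _ (\sum_i #|A|%:R * \sum_p (M p *m v) i 0 ^+ 2)).
  apply: ler_sum => i _; rewrite mulmx_suml summxE.
  have := cauchy_schwarz (fun p => (M p *m v) i 0) (fun=> 1).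
  under eq_bigr do rewrite mulr1; move=> /le_trans; apply.
  by under [X in _ * X <= _]eq_bigr do rewrite expr1n; rewrite sumr_const mulrC.
rewrite -mulr_sumr exchange_big /=.
under eq_bigr => p _.
  rewrite /M -mulmxA sqr_sum_mulmx; last exact/orthogonal_tr/oQ.
  over.
rewrite -(pair_bigA _ (fun e c => \sum_j ((signed_shift T e c)^T *m v) j 0 ^+ 2))/=.
rewrite signed_shift_average exprMn expr_div_n sqr_fro sqr_sqrtr ?ler0n//.
rewrite le_eqVlt; apply/orP; left; apply/eqP.
by rewrite cardA; field; rewrite gt_eqF.
Qed.

Section Expect.
Variables (J : finType) (w x : J -> R) (sg : J -> J).
Hypothesis w_ge0 : forall j, 0 <= w j.
Hypothesis w_sum1 : \sum_j w j = 1.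
Hypothesis sgK : involutive sg.
Hypothesis w_sg : forall j, w (sg j) = w j.
Hypothesis x_sg : forall j, x (sg j) = - x j.

(** Permuting and signing the rows of [T] amounts to doing so with the columns of [g], which
    preserves the law exactly. *)
Lemma expect_signed_shift d (T : 'M[R]_d.+1) e c :
  expect w x (fun g : 'I_d.+1 * 'I_d.+1 -> R => nuc (mxof g *m signed_shift T e c)) =
  expect w x (fun g : 'I_d.+1 * 'I_d.+1 -> R => nuc (mxof g *m T)).
Proof.
pose pi (p : 'I_d.+1 * 'I_d.+1) := (p.1, p.2 - c).
have pi_inj : injective pi.
  move=> [i k] [i' k'] ikE; have /= -> := congr1 fst ikE.
  by have /= /addIr -> := congr1 snd ikE.
rewrite -[RHS](expect_perm w x _ pi_inj).
rewrite -[RHS](expect_sign sgK w_sg x_sg (fun p => e p.2)).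
apply: eq_expect => f; congr nuc; apply/matrixP => i j; rewrite !mxE.
rewrite [RHS](reindex_inj (addIr c)) /=; apply: eq_bigr => k _.
  by rewrite !mxE /= /pi /= !addrK; ring.
Qed.

Lemma expect_nuc_mul_le d (T : 'M[R]_d.+1) :
  expect w x (fun g : 'I_d.+1 * 'I_d.+1 -> R => nuc (mxof g *m T)) <=
  fro T / Num.sqrt d.+1%:R *
    expect w x (fun g : 'I_d.+1 * 'I_d.+1 -> R => nuc (mxof g)).
Proof.
have N0 : 0 < 2 ^+ d.+1 * d.+1%:R :> R by rewrite mulr_gt0 ?ltr0n// exprn_gt0.
rewrite -(ler_pM2l N0) mulrA -[leRHS]expectZ.
apply: (@le_trans _ _ (expect w x (fun g : 'I_d.+1 * 'I_d.+1 -> R =>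
  \sum_(e : {ffun 'I_d.+1 -> bool}) \sum_c nuc (mxof g *m signed_shift T e c)))).
  rewrite expect_sum (eq_bigr (fun=> d.+1%:R * expect w x
      (fun g : 'I_d.+1 * 'I_d.+1 -> R => nuc (mxof g *m T)))).
    rewrite sumr_const card_ffun card_bool card_ord -[leRHS]mulr_natl natrX.
    by rewrite mulrA.
  move=> e _; rewrite expect_sum (eq_bigr (fun=> expect w x
      (fun g : 'I_d.+1 * 'I_d.+1 -> R => nuc (mxof g *m T)))).
    by rewrite sumr_const card_ord mulr_natl.
  by move=> c _; exact: expect_signed_shift.
apply: le_expect => // g; exact: sum_nuc_signed_shift.
Qed.

(** Enumerating [I'] turns both sides into the same [iter_sum]; [i0] is the default of [nth]. *)
Lemma expect_marginal (I' I : finType) (i0 : I') (io : I' -> I)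
    (F : (I' -> R) -> R) : injective io ->
  expect w x (fun g : I -> R => F (g \o io)) = expect w x F.
Proof.
move=> io_inj.
pose h (t : nat) : I' := nth i0 (enum I') t.
have hK i : h (enum_rank i) = i by rewrite /h nth_enum_rank.
pose F' (u : nat -> R) := F (fun i => u (enum_rank i)).
have h_inj i j : (i < #|I'|)%N -> (j < #|I'|)%N -> h i = h j -> i = j.
  move=> iI jI /eqP; rewrite /h nth_uniq -?cardE ?enum_uniq// => /eqP.
  by [].
transitivity (iter_sum w x #|I'| F').
  rewrite -(iter_sum_expect x w_sum1 (h := io \o h) F'); last first.
    by move=> i j iI jI /io_inj; exact: h_inj.
  apply: eq_expect => f; congr F; apply/funext => i /=.
  by rewrite ltn_ord hK.
rewrite -(iter_sum_expect x w_sum1 F' h_inj).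
apply: eq_expect => f; congr F; apply/funext => i /=.
by rewrite ltn_ord hK.
Qed.

Section Elimination.
Variable kappa : R.
Hypothesis kappa_ge0 : 0 <= kappa.
Hypothesis rotation_approx : forall (f : R -> R -> R) (L c s : R),
  0 <= L -> (forall u v, 0 <= f u v) ->
  (forall u v u' v', `|f u v - f u' v'| <= L * (`|u - u'| + `|v - v'|)) ->
  0 <= c -> c ^+ 2 + s ^+ 2 = 1 ->
  `|\sum_a w a * (\sum_b w b * f (c * x a + s * x b) (- s * x a + c * x b))
    - \sum_a w a * (\sum_b w b * f (x a) (x b))| <= L * kappa.

Lemma expect_nuc_givens d n (Y : 'M[R]_(n, d)) p q c s :
  p != q -> 0 <= c -> c ^+ 2 + s ^+ 2 = 1 ->
  `|expect w x (fun g : 'I_d * 'I_n -> R => nuc (mxof g *m (givens p q c s *m Y))) -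
    expect w x (fun g : 'I_d * 'I_n -> R => nuc (mxof g *m Y))|
  <= (2 ^+ d - 1) * (d%:R * fro Y * kappa).
Proof.
move=> pq c0 cs; set l := [seq ((a, p), (a, q)) | a <- enum 'I_d].
(* The angle is reversed because [mxof_rots] produces the transposed rotation. *)
have := @expect_rots R J w x w_ge0 w_sum1 kappa rotation_approx _
  (d%:R * fro Y) (fun g : 'I_d * 'I_n -> R => nuc (mxof g *m Y)) c (- s) l.
rewrite size_map size_enum_ord.
rewrite (_ : _ \o _ = fun g => nuc (mxof g *m (givens p q c s *m Y))); last first.
  apply/funext => g /=; rewrite mxof_rots// givens_tr// opprK mulmxA.
  by [].
apply => //.
- by rewrite mulr_ge0// fro_ge0.
- by apply/allP => _ /mapP[a _ ->] /=; rewrite xpair_eqE negb_and pq orbT.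
- by rewrite sqrrN.
- exact: lipschitz_nuc_mul.
- by move=> g; exact: nuc_ge0.
Qed.

(** After elimination only the upper square block [T] is nonzero, so [g] matters only through its
    first [d.+1] columns, and the square case applies. *)
Lemma expect_nuc_rect_le d k (Y : 'M[R]_(d.+1 + k, d.+1)) :
  expect w x (fun g : 'I_d.+1 * 'I_(d.+1 + k) -> R => nuc (mxof g *m Y)) <=
  (expect w x (fun g : 'I_d.+1 * 'I_d.+1 -> R => nuc (mxof g)) / Num.sqrt d.+1%:R
   + (d.+1 * (d.+1 + k))%:R * (2 ^+ d.+1 * (d.+1%:R * kappa))) * fro Y.
Proof.
pose Phi (Z : 'M[R]_(d.+1 + k, d.+1)) := expect w x
  (fun g : 'I_d.+1 * 'I_(d.+1 + k) -> R => nuc (mxof g *m Z)).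
pose e := 2 ^+ d.+1 * (d.+1%:R * fro Y * kappa).
have fk : 0 <= d.+1%:R * fro Y * kappa by rewrite !mulr_ge0// fro_ge0.
have e0 : 0 <= e by rewrite mulr_ge0// exprn_ge0.
have [|Z [Z1 Z2 Z3]] := @givens_elimination R _ _ Y Phi e e0.
  move=> Z p q c s pq c0 cs ZY; rewrite (le_trans (expect_nuc_givens Z pq c0 cs))//.
  rewrite (_ : fro Z = fro Y); last by rewrite /fro ZY.
  by rewrite ler_wpM2r// gerBl.
pose T := usubmx Z.
have ZE : Z = col_mx T 0.
  rewrite -[LHS]vsubmxK; congr col_mx; apply/matrixP => i j; rewrite !mxE Z2//=.
  by rewrite (leq_trans (ltn_ord j))// leq_addr.
have fT : fro T = fro Y.
  rewrite /fro -Z1 !fro2_trace ZE tr_col_mx trmx0 mul_row_col mul0mx addr0.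
  by [].
have PhiZ : Phi Z = expect w x (fun g : 'I_d.+1 * 'I_d.+1 -> R => nuc (mxof g *m T)).
  pose io (p : 'I_d.+1 * 'I_d.+1) : 'I_d.+1 * 'I_(d.+1 + k) := (p.1, lshift k p.2).
  have io_inj : injective io.
    move=> [i j] [i' j'] ijE; have /= -> := congr1 fst ijE.
    by have /= /lshift_inj -> := congr1 snd ijE.
  rewrite -(expect_marginal (ord0, ord0) _ io_inj); apply: eq_expect => f.
  congr nuc; rewrite ZE -[mxof _ in LHS]hsubmxK mul_row_col mulmx0 addr0.
  by congr (_ *m _); apply/matrixP => i j; rewrite !mxE.
have := expect_nuc_mul_le T; rewrite -PhiZ fT => h.
rewrite -/(Phi Y) -(subrK (Phi Z) (Phi Y)) addrC mulrDl lerD//.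
  by rewrite mulrAC -mulrA mulrC.
rewrite (le_trans (ler_norm _))// (le_trans Z3)// -mulrA ler_wpM2l//.
by rewrite /e le_eqVlt; apply/orP; left; apply/eqP; ring.
Qed.

End Elimination.
End Expect.
End SignedShiftAverage.

(** * Second and fourth moments, and the relaxed problem *)

Section Moments.
Context {R : realType}.
Variables (J : finType) (w x : J -> R) (sg : J -> J).
Hypothesis w_ge0 : forall j, 0 <= w j.
Hypothesis w_sum1 : \sum_j w j = 1.
Hypothesis sgK : involutive sg.
Hypothesis w_sg : forall j, w (sg j) = w j.
Hypothesis x_sg : forall j, x (sg j) = - x j.
Let tau2 := \sum_j w j * x j ^+ 2.
Let tau4 := \sum_j w j * x j ^+ 4.

Lemma expect_coord (I : finType) (p : I) (h : R -> R) :
  expect w x (fun g : I -> R => h (g p)) = \sum_j w j * h (x j).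
Proof.
rewrite -(expect_resample x w_sum1 p) /resample.
under eq_fun => f do under eq_bigr => a _ do rewrite /upd eqxx.
exact: expect_cst.
Qed.

Lemma expect_coord2 (I : finType) (p q : I) (h k : R -> R) : p != q ->
  expect w x (fun g : I -> R => h (g p) * k (g q)) =
  (\sum_j w j * h (x j)) * (\sum_j w j * k (x j)).
Proof.
move=> pq; rewrite -(expect_resample x w_sum1 p) /resample.
rewrite -(expect_coord q k) -expectZ; apply: eq_expect => f.
rewrite mulr_suml; apply: eq_bigr => a _.
by rewrite /upd eqxx eq_sym (negbTE pq) mulrA.
Qed.

Lemma expect_odd (I : finType) (p q r s : I) : q != p -> r != p -> s != p ->
  expect w x (fun g : I -> R => g p * g q * g r * g s) = 0.
Proof.
move=> qp rp sp; have := expect_sign sgK w_sg x_sg (pred1 p)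
  (fun g : I -> R => g p * g q * g r * g s).
under eq_fun => f.
  rewrite /= eqxx (negbTE qp) (negbTE rp) (negbTE sp) !expr0 expr1 !mul1r.
  rewrite mulN1r !mulNr. over.
by rewrite expectN => h; lra.
Qed.

Lemma sqr_tau2_le : tau2 ^+ 2 <= tau4.
Proof.
rewrite -subr_ge0.
have -> : tau4 - tau2 ^+ 2 = \sum_j w j * (x j ^+ 2 - tau2) ^+ 2.
  have -> : \sum_j w j * (x j ^+ 2 - tau2) ^+ 2 =
      \sum_j (w j * x j ^+ 4 + (- 2 * tau2) * (w j * x j ^+ 2) + tau2 ^+ 2 * w j).
    by apply: eq_bigr => j _; ring.
  by rewrite !big_split /= -!mulr_sumr w_sum1 -/tau4 -/tau2; ring.
by apply: sumr_ge0 => j _; rewrite mulr_ge0// sqr_ge0.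
Qed.

(** The four positions are corners of a rectangle: by symmetry the mean vanishes unless it
    degenerates. Bounding [tau2 ^+ 2] by [tau4] when [j = l] affects only terms of lower order in
    [n]. *)
Lemma expect_fourth_le m n (a b : 'I_m) (j l : 'I_n) :
  expect w x (fun g : 'I_m * 'I_n -> R => g (a, j) * g (a, l) * g (b, j) * g (b, l))
  <= (a == b)%:R * tau2 ^+ 2 + (j == l)%:R * tau4.
Proof.
have t2 : 0 <= tau2 ^+ 2 by exact: sqr_ge0.
have t24 := sqr_tau2_le.
have sq u v : u != v -> expect w x (fun g : 'I_m * 'I_n -> R =>
    g u ^+ 2 * g v ^+ 2) = tau2 ^+ 2.
  by move=> uv; rewrite (expect_coord2 (fun t => t ^+ 2) (fun t => t ^+ 2) uv) -expr2.
have [ab|ab] := eqVneq a b; have [jl|jl] := eqVneq j l; rewrite /= ?mul1r ?mul0r ?addr0 ?add0r.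
- subst b l; rewrite (@eq_expect R J w x _ _ (fun g => g (a, j) ^+ 4)); last by move=> f /=; ring.
  by rewrite (expect_coord _ (fun t => t ^+ 4)) -/tau4 lerDr.
- subst b; rewrite (@eq_expect R J w x _ _ (fun g => g (a, j) ^+ 2 * g (a, l) ^+ 2));
    last by move=> f /=; ring.
  by rewrite sq// xpair_eqE eqxx.
- subst l; rewrite (@eq_expect R J w x _ _ (fun g => g (a, j) ^+ 2 * g (b, j) ^+ 2));
    last by move=> f /=; ring.
  by rewrite sq// xpair_eqE (negbTE ab).
- by rewrite expect_odd// xpair_eqE ?eqxx ?andbT ?andbF
    ?(eq_sym l) ?(eq_sym b) ?(negbTE jl) ?(negbTE ab).
Qed.

Lemma expect_trace_sqr m n :
  expect w x (fun g : 'I_m * 'I_n -> R => \tr ((mxof g)^T *m mxof g)) =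
  (m * n)%:R * tau2.
Proof.
under eq_fun do rewrite -fro2_trace /fro2.
rewrite expect_sum (eq_bigr (fun=> n%:R * tau2)).
  by rewrite sumr_const card_ord -[LHS]mulr_natl mulrA natrM.
move=> i _; rewrite expect_sum (eq_bigr (fun=> tau2)).
  by rewrite sumr_const card_ord mulr_natl.
move=> j _; under eq_fun do rewrite mxE.
exact: (expect_coord _ (fun t => t ^+ 2)).
Qed.

Lemma expect_trace_fourth_le m n :
  expect w x (fun g : 'I_m * 'I_n -> R =>
    \tr ((mxof g)^T *m mxof g *m ((mxof g)^T *m mxof g))) <=
  m%:R * n%:R ^+ 2 * tau2 ^+ 2 + m%:R ^+ 2 * n%:R * tau4.
Proof.
have E (V : 'M[R]_(m, n)) : \tr (V^T *m V *m (V^T *m V)) =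
    \sum_j \sum_l \sum_a \sum_b V a j * V a l * V b j * V b l.
  rewrite /mxtrace; apply: eq_bigr => j _; rewrite mxE; apply: eq_bigr => l _.
  rewrite !mxE big_distrlr /=; apply: eq_bigr => a _; apply: eq_bigr => b _.
  by rewrite !mxE; ring.
under eq_fun do rewrite E.
rewrite expect_sum.
apply: (@le_trans _ _ (\sum_(j < n) \sum_(l < n) \sum_(a < m) \sum_(b < m)
    ((a == b)%:R * tau2 ^+ 2 + (j == l)%:R * tau4))).
  apply: ler_sum => j _; rewrite expect_sum; apply: ler_sum => l _.
  rewrite expect_sum; apply: ler_sum => a _; rewrite expect_sum.
  apply: ler_sum => b _; under eq_fun do rewrite !mxE.
  exact: expect_fourth_le.
have delta1 (N : nat) (i : 'I_N) (c : R) : \sum_k (i == k)%:R * c = c.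
  rewrite (bigD1 i)//= eqxx mul1r big1 ?addr0// => k.
  by rewrite eq_sym => /negbTE ->; rewrite mul0r.
have S1 (j l : 'I_n) : \sum_(a < m) \sum_(b < m)
    ((a == b)%:R * tau2 ^+ 2 + (j == l)%:R * tau4) =
    m%:R * tau2 ^+ 2 + (j == l)%:R * (m%:R ^+ 2 * tau4).
  under eq_bigr do rewrite big_split/= delta1 sumr_const card_ord.
  by rewrite sumr_const card_ord -[LHS]mulr_natl -[X in _ * (_ + X)]mulr_natl; ring.
under eq_bigr do under eq_bigr do rewrite S1.
under eq_bigr do rewrite big_split/= delta1 sumr_const card_ord.
rewrite sumr_const card_ord -[leLHS]mulr_natl -[X in _ * (X + _) <= _]mulr_natl le_eqVlt.
apply/orP; left; apply/eqP; ring.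
Qed.

(** [r ^+ 2 = D * tau2] is the mean squared length of a row. The main terms combine as
    [3 / 2 - 1 / 2 = 1]; the remainder of the fourth moment is of relative order [1 / D]. *)
Lemma expect_coisometry_trace_ge d k :
  0 < tau2 -> (0 < d + k)%N ->
  exists X : {ffun 'I_d * 'I_(d + k) -> J} -> 'M[R]_(d, d + k),
    (forall f, X f *m (X f)^T = 1%:M) /\
    Num.sqrt ((d + k)%:R * tau2) * d%:R *
      (1 - d%:R * tau4 / (2 * (d + k)%:R * tau2 ^+ 2)) <=
    \sum_f weight w f * \tr ((mxof (x \o f))^T *m X f).
Proof.
move=> t2 D0.
set D : R := (d + k)%:R; have D0' : 0 < D by rewrite ltr0n.
set r := Num.sqrt _; have r0 : 0 < r by rewrite sqrtr_gt0 mulr_gt0.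
have r2 : r ^+ 2 = D * tau2 by rewrite sqr_sqrtr// ltW// mulr_gt0.
have r4 : r ^+ 4 = D ^+ 2 * tau2 ^+ 2 by rewrite (exprM r 2 2) r2 exprMn.
pose tr2 (g : 'I_d * 'I_(d + k) -> R) := \tr ((mxof g)^T *m mxof g).
pose tr4 (g : 'I_d * 'I_(d + k) -> R) :=
  \tr ((mxof g)^T *m mxof g *m ((mxof g)^T *m mxof g)).
have H (f : {ffun 'I_d * 'I_(d + k) -> J}) : exists X : 'M[R]_(d, d + k),
    X *m X^T = 1%:M /\ r * (3 / 2 * (tr2 (x \o f) / r ^+ 2)
      - 2^-1 * (tr4 (x \o f) / r ^+ 4)) <= \tr ((mxof (x \o f))^T *m X).
  by have [X X1 X2] := coisometry_trace_ge (mxof (x \o f) : 'M[R]_(d, d + k)) r0; exists X.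
have [X XP] := choice H; exists X; split; first by move=> f; case: (XP f).
apply: (@le_trans _ _ (expect w x (fun g => (r * (3 / 2) / r ^+ 2) * tr2 g
    + (- (r * 2^-1 / r ^+ 4)) * tr4 g))); last first.
  apply: ler_sum => f _; apply: ler_wpM2l; first exact: weight_ge0.
  case: (XP f) => _; apply: le_trans; rewrite le_eqVlt; apply/orP; left; apply/eqP.
  by ring.
rewrite expectD !expectZ expect_trace_sqr.
have h := expect_trace_fourth_le d (d + k).
have c0 : 0 <= r * 2^-1 / r ^+ 4 by rewrite divr_ge0 ?exprn_ge0 ?mulr_ge0// ?ltW// invr_ge0.
have {}h := ler_wpM2l c0 h; rewrite -/D in h.
rewrite mulNr; apply: le_trans (lerB (lexx _) h).
rewrite natrM -/D r4 r2 le_eqVlt; apply/orP; left; apply/eqP.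
by field; rewrite -natrD !gt_eqF.
Qed.

End Moments.

(** * Both optimisation problems for a Gram matrix *)

Section GramMatrix.
Context {R : realType}.
Variables (n d D : nat) (W : 'I_n -> 'M[R]_(d, D)).

(* [mxvec] provides the row index used by [block]. *)
Definition stack : 'M[R]_(n * d, D) :=
  \matrix_(p, k) mxvec (\matrix_(i, a) W i a k) 0 p.

Definition gram : 'M[R]_(n * d) := stack *m stack^T.

Lemma block_gram i j : block gram i j = W i *m (W j)^T.
Proof.
apply/matrixP => a b; rewrite !mxE; apply: eq_bigr => k _.
by rewrite !mxE !mxvecE !mxE.
Qed.

Lemma gram_psd : sym_psd gram.
Proof.
split; first by rewrite /gram trmx_mul trmxK.
move=> v; rewrite /gram mulmxA -mulmxA -trmx_mul mxE.
by apply: sumr_ge0 => i _; rewrite [X in _ * X]mxE -expr2 sqr_ge0.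
Qed.

Lemma gram_value p (X : 'I_n -> 'M[R]_(d, p)) :
  \sum_(i < n) \sum_(j < n) \tr ((block gram i j)^T *m X i *m (X j)^T) =
  fro2 (\sum_i (W i)^T *m X i).
Proof.
pose Z := \sum_(i < n) (W i)^T *m X i; rewrite fro2_trace -/Z.
have -> : \tr (Z^T *m Z) = \tr (Z *m Z^T) by rewrite mxtrace_mulC.
rewrite {1}/Z mulmx_suml raddf_sum /=; apply: eq_bigr => i _.
rewrite /Z raddf_sum mulmx_sumr raddf_sum /=; apply: eq_bigr => j _.
rewrite block_gram !trmx_mul !trmxK -!mulmxA mxtrace_mulC -!mulmxA.
by [].
Qed.

(** The hypothesis is applied with [Y] equal to [Z], the sum of the [(W i)^T *m Q i]: this gives
    [fro Z ^+ 2 <= K * fro Z]. *)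
Lemma orth_value_gram_le (K : R) : 0 <= K ->
  (forall (Y : 'M[R]_(D, d)) (Q : 'I_n -> 'M[R]_d), (forall i, orthogonal (Q i)) ->
     \sum_i \tr ((W i *m Y)^T *m Q i) <= K * fro Y) ->
  orth_value gram <= K ^+ 2.
Proof.
move=> K0 HK; apply: ge_sup.
  exists (\sum_(i < n) \sum_(j < n) \tr ((block gram i j)^T *m 1%:M *m 1%:M^T)).
  by exists (fun=> 1%:M); split => // i; exact: orthogonal1.
move=> _ [Q [oQ ->]]; rewrite gram_value; set Z := \sum_i _.
have := HK Z Q oQ.
have -> : \sum_i \tr ((W i *m Z)^T *m Q i) = fro Z ^+ 2.
  rewrite sqr_fro fro2_trace {3}/Z mulmx_sumr raddf_sum /=; apply: eq_bigr => i _.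
  by rewrite trmx_mul mulmxA.
move=> h; rewrite -sqr_fro; have f0 := fro_ge0 Z.
rewrite ler_pXn2r ?nnegrE//.
have [->//|fn] := eqVneq (fro Z) 0.
have fp : 0 < fro Z by rewrite lt_def fn.
by rewrite -(ler_pM2r fp) -expr2.
Qed.

(** The coisometry [E] embeds dimension [D] into the required [n * d]. Cauchy-Schwarz against [E],
    whose squared norm is [D], yields the denominator. *)
Lemma sdp_value_gram_ge (X : 'I_n -> 'M[R]_(d, D)) :
  (0 < D)%N -> (D <= n * d)%N -> (forall i, X i *m (X i)^T = 1%:M) ->
  (\sum_i \tr ((W i)^T *m X i)) ^+ 2 / D%:R <= sdp_value gram.
Proof.
move=> D0 Dn XX; pose E : 'M[R]_(D, n * d) := pid_mx D.
have EE : E *m E^T = 1%:M.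
  by rewrite /E tr_pid_mx mul_pid_mx minnn (minn_idPr Dn) pid_mx_1.
pose X' i := X i *m E.
have XX' i : X' i *m (X' i)^T = 1%:M.
  by rewrite /X' trmx_mul mulmxA -(mulmxA (X i)) EE mulmx1.
apply: (@le_trans _ _ (\sum_(i < n) \sum_(j < n)
    \tr ((block gram i j)^T *m X' i *m (X' j)^T))); last first.
  apply: ub_le_sup; last by exists X'.
  (* The supremum needs an upper bound; the entries of [Y i *m (Y j)^T] are at most 1 in modulus. *)
  pose B := \sum_(i < n) \sum_(j < n) \sum_a \sum_b `|block gram i j a b|.
  exists B => _ [Y [YY ->]]; apply: ler_sum => i _; apply: ler_sum => j _.
  rewrite -mulmxA mxtrace_mul; apply: ler_sum => a _; apply: ler_sum => b _.
  rewrite (le_trans (ler_norm _))// normrM ler_piMr//.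
  rewrite -(@ler_pXn2r _ 2%N) ?nnegrE// real_normK ?num_real// expr1n mxE.
  have := cauchy_schwarz (fun k => Y i a k) (fun k => Y j b k).
  rewrite !coisometry_row// mulr1; apply: le_trans; rewrite le_eqVlt.
  by apply/orP; left; apply/eqP; congr (_ ^+ 2); apply: eq_bigr => k _; rewrite mxE.
rewrite gram_value; set Z := \sum_i (W i)^T *m X' i.
have -> : \sum_i \tr ((W i)^T *m X i) = \tr (E^T *m Z).
  rewrite /Z mulmx_sumr raddf_sum /=; apply: eq_bigr => i _.
  by rewrite [RHS]mxtrace_mulC /X' -!mulmxA EE mulmx1.
have D0R : 0 < D%:R :> R by rewrite ltr0n.
rewrite ler_pdivrMr// mxtrace_mul.
rewrite pair_bigA /=.
have := cauchy_schwarz (fun p : 'I_D * 'I_(n * d) => Z p.1 p.2) (fun p => E p.1 p.2).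
rewrite -(pair_bigA _ (fun i j => Z i j ^+ 2))/= -(pair_bigA _ (fun i j => E i j ^+ 2))/=.
rewrite (_ : \sum_i \sum_j E i j ^+ 2 = D%:R); last first.
  under eq_bigr do rewrite coisometry_row//.
  by rewrite sumr_const card_ord.
apply: le_trans; rewrite le_eqVlt; apply/orP; left; apply/eqP; congr (_ ^+ 2).
by apply: eq_bigr => p _; rewrite mulrC.
Qed.

End GramMatrix.

(** * Comparison with [alpha_R] *)

Section Alpha.
Context {R : realType}.

Lemma sum_ord_mul (m n : nat) (h : nat -> R) :
  \sum_(t < m * n) h t = \sum_(i < m) \sum_(j < n) h (i * n + j)%N.
Proof.
elim: m => [|m ih]; first by rewrite !big_ord0.
by rewrite mulSnr big_split_ord big_ord_recr /= ih.
Qed.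

Definition unroll (d : nat) (g : nat -> R) : R :=
  nuc (\matrix_(i < d, j < d) g (i * d + j)%N) / d%:R.

Lemma liph_unroll d : (0 < d)%N -> liph (d * d) 1 (unroll d).
Proof.
move=> d0 g g'; have dR : 1 <= d%:R :> R by rewrite ler1n.
rewrite /unroll -mulrBl normrM mul1r [X in _ * X <= _]ger0_norm ?invr_ge0//.
apply: (@le_trans _ _ `|nuc (\matrix_(i < d, j < d) g (i * d + j)%N)
    - nuc (\matrix_(i < d, j < d) g' (i * d + j)%N)|).
  by rewrite ler_piMr// invf_le1// (lt_le_trans ltr01).
rewrite (le_trans (nuc_lipschitz _ _))//.
rewrite (sum_ord_mul d d (fun t => `|g t - g' t|)) le_eqVlt; apply/orP; left; apply/eqP.
by apply: eq_bigr => i _; apply: eq_bigr => j _; rewrite !mxE.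
Qed.

Lemma unroll_ge0 d g : 0 <= unroll d g.
Proof. by rewrite divr_ge0// nuc_ge0. Qed.

Lemma iter_sum_unroll (J : finType) (w x : J -> R) d : \sum_j w j = 1 ->
  iter_sum w x (d.+1 * d.+1) (unroll d.+1) =
  expect w x (fun g : 'I_d.+1 * 'I_d.+1 -> R => nuc (mxof g)) / d.+1%:R.
Proof.
move=> w1; pose h t : 'I_d.+1 * 'I_d.+1 := (inord (t %/ d.+1), inord (t %% d.+1)).
have hd t : (t < d.+1 * d.+1)%N -> (t %/ d.+1 < d.+1)%N by move=> ?; rewrite ltn_divLR.
have h_inj i j : (i < d.+1 * d.+1)%N -> (j < d.+1 * d.+1)%N -> h i = h j -> i = j.
  move=> iN jN hij.
  have := congr1 (fun p => val p.1) hij; rewrite /= !inordK ?hd// => e1.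
  have := congr1 (fun p => val p.2) hij; rewrite /= !inordK ?ltn_pmod// => e2.
  by rewrite (divn_eq i d.+1) (divn_eq j d.+1) e1 e2.
rewrite -(iter_sum_expect x w1 _ h_inj) mulrC -expectZ; apply: eq_expect => f.
rewrite /unroll mulrC; congr (_ * nuc _); apply/matrixP => i j; rewrite !mxE.
have ij : (i * d.+1 + j < d.+1 * d.+1)%N.
  apply: (@leq_trans (i.+1 * d.+1)); first by rewrite mulSnr ltn_add2l.
  by rewrite leq_mul2r ltn_ord orbT.
rewrite ij /h; congr (x (f (_, _))); apply/val_inj; rewrite /= inordK ?hd//.
  by rewrite divnMDl// divn_small ?addn0.
  by rewrite modnMDl modn_small.
by rewrite ltn_pmod.
Qed.

Lemma alpha_R_giter d : (0 < d)%N ->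
  alpha_R (R := R) d = giter (Num.sqrt d%:R)^-1 (d * d) (unroll d).
Proof.
move=> d0; have s0 : 0 < (Num.sqrt d%:R)^-1 :> R by rewrite invr_gt0 sqrtr_gt0 ltr0n.
by rewrite /alpha_R (gauss_iter_giter s0 ler01 (liph_unroll d0)).
Qed.

Lemma alpha_R_ge0 d : (0 < d)%N -> 0 <= alpha_R (R := R) d.
Proof.
move=> d0; have s0 : 0 < (Num.sqrt d%:R)^-1 :> R by rewrite invr_gt0 sqrtr_gt0 ltr0n.
rewrite alpha_R_giter//; apply: (giter_ge0 s0 ler01 (liph_unroll d0)) => g.
exact: unroll_ge0.
Qed.

(** All [d.+1 ^ 2] entries are replaced, each at cost [delta] since [unroll] is 1-Lipschitz. *)
Lemma expect_nuc_le_alpha d delta K4 (J : finType) (w x : J -> R) (sg : J -> J) :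
  gauss_approx (Num.sqrt d.+1%:R)^-1 delta K4 w x sg ->
  expect w x (fun g : 'I_d.+1 * 'I_d.+1 -> R => nuc (mxof g)) <=
  d.+1%:R * (alpha_R (R := R) d.+1 + d.+1%:R ^+ 2 * delta).
Proof.
move=> wx.
have s0 : 0 < (Num.sqrt d.+1%:R)^-1 :> R by rewrite invr_gt0 sqrtr_gt0 ltr0n.
have dR : 0 < d.+1%:R :> R by rewrite ltr0n.
have := giter_iter_sum s0 wx ler01 (liph_unroll (ltn0Sn d)) (unroll_ge0 d.+1).
rewrite -alpha_R_giter// iter_sum_unroll ?(approx_sum1 wx)// mul1r natrM -expr2.
rewrite distrC => /(le_trans (ler_norm _)).
by rewrite lerBlDl ler_pdivrMr// mulrC.
Qed.

End Alpha.

(** * Values of the discretised Gaussian Gram matrix *)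

Section Construction.
Context {R : realType}.
Variables (d k : nat) (delta K4 : R) (J : finType) (w x : J -> R) (sg : J -> J).
Hypothesis delta_ge0 : 0 <= delta.
Hypothesis wx : gauss_approx (Num.sqrt d.+1%:R)^-1 delta K4 w x sg.
Let D := (d.+1 + k)%N.
Let Omega := {ffun 'I_d.+1 * 'I_D -> J}.
(** The probability is a factor of the block, so sums over blocks are expectations. *)
Let W (i : 'I_#|{: Omega}|) : 'M[R]_(d.+1, D) :=
  weight w (enum_val i) *: mxof (x \o enum_val i).
Let dR : 0 < d.+1%:R :> R. Proof. by rewrite ltr0n. Qed.
Let s0 : 0 < (Num.sqrt d.+1%:R)^-1 :> R.
Proof. by rewrite invr_gt0 sqrtr_gt0. Qed.

Let sum_Omega (F : Omega -> R) :
  \sum_f F f = \sum_(i < #|{: Omega}|) F (enum_val i).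
Proof. by rewrite -big_enum_val; exact: eq_bigl. Qed.

Lemma gauss_gram_orth_value_le :
  orth_value (gram W) <=
  (Num.sqrt d.+1%:R * (alpha_R (R := R) d.+1
    + (d.+1%:R ^+ 2 + 6 * (d.+1 * D)%:R * 2 ^+ d.+1 * d.+1%:R) * delta)) ^+ 2.
Proof.
apply: orth_value_gram_le.
  apply: mulr_ge0; first exact: sqrtr_ge0.
  apply: addr_ge0; first exact: alpha_R_ge0.
  by rewrite mulr_ge0// addr_ge0 ?exprn_ge0// !mulr_ge0 ?exprn_ge0.
move=> Y Q oQ.
apply: (@le_trans _ _ (expect w x (fun g : 'I_d.+1 * 'I_D -> R => nuc (mxof g *m Y)))).
  rewrite /expect sum_Omega.
  apply: ler_sum => i _; rewrite /W -scalemxAl linearZ /= -scalemxAl linearZ /=.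
  apply: ler_wpM2l; first by apply: weight_ge0; exact: approx_ge0 wx.
  exact: mxtrace_orthogonal_le_nuc.
have rapp := gauss_approx_rotation s0 wx.
have kap0 : 0 <= 6 * delta by rewrite mulr_ge0.
have := expect_nuc_rect_le (approx_ge0 wx) (approx_sum1 wx) (approx_sgK wx)
  (approx_w_sg wx) (approx_x_sg wx) kap0 rapp Y.
move=> /le_trans; apply; apply: ler_wpM2r; first exact: fro_ge0.
have h := expect_nuc_le_alpha wx.
set A := expect _ _ _ in h *.
have sq1 : 1 <= Num.sqrt d.+1%:R :> R.
  by rewrite -[leLHS]sqrtr1 ler_wsqrtr// ler1n.
have sq0 : 0 < Num.sqrt d.+1%:R :> R by rewrite sqrtr_gt0.
have h1 : A / Num.sqrt d.+1%:R <= Num.sqrt d.+1%:R *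
    (alpha_R (R := R) d.+1 + d.+1%:R ^+ 2 * delta).
  rewrite ler_pdivrMr//; apply: le_trans h _; rewrite le_eqVlt; apply/orP; left.
  by apply/eqP; rewrite -{1}(sqr_sqrtr (ler0n R d.+1)); ring.
set c := (d.+1 * (d.+1 + k))%:R * (2 ^+ d.+1 * (d.+1%:R * (6 * delta))).
have c0 : 0 <= c by rewrite !mulr_ge0 ?exprn_ge0.
(* Enlarging the elimination error lets the common square root be factored out. *)
have h2 : c <= Num.sqrt d.+1%:R * c by rewrite ler_peMl.
rewrite (le_trans (lerD h1 h2))// -mulrDr ler_pM2l// le_eqVlt; apply/orP; left; apply/eqP.
by rewrite /c /D; ring.
Qed.

Let tau2 := \sum_j w j * x j ^+ 2.

Lemma gauss_gram_sdp_value_ge (u : R) : 0 < tau2 -> 0 <= u -> u <= 1 ->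
  d.+1%:R * K4 <= u * (2 * D%:R * tau2 ^+ 2) ->
  tau2 * (d.+1%:R * (1 - u)) ^+ 2 <= sdp_value (gram W).
Proof.
move=> t2 u0 u1 hu.
have D0 : (0 < D)%N by [].
have D0R : 0 < D%:R :> R by rewrite ltr0n.
have [X [XX hX]] := expect_coisometry_trace_ge (approx_ge0 wx) (approx_sum1 wx)
  (approx_sgK wx) (approx_w_sg wx) (approx_x_sg wx) t2 D0.
pose X' (i : 'I_#|{: Omega}|) := X (enum_val i).
(* With at least two atoms, [Omega] has at least [2 ^ D] points. *)
have Dn : (D <= #|{: Omega}| * d.+1)%N.
  apply: (@leq_trans #|{: Omega}|); last by rewrite leq_pmulr.
  rewrite card_ffun card_prod !card_ord.
  apply: (@leq_trans (2 ^ D)); first by apply: ltnW; exact: ltn_expl.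
  apply: (@leq_trans (2 ^ (d.+1 * D))); first by rewrite leq_exp2l// leq_pmull.
  by rewrite leq_exp2r ?muln_gt0// (approx_card wx).
have := sdp_value_gram_ge W (X := X') D0 Dn (fun i => XX (enum_val i)).
apply: le_trans.
have -> : \sum_i \tr ((W i)^T *m X' i) =
    \sum_f weight w f * \tr ((mxof (x \o f))^T *m X f).
  rewrite sum_Omega.
  by apply: eq_bigr => i _; rewrite /W linearZ /= -scalemxAl linearZ.
rewrite ler_pdivlMr//.
set S := \sum_f weight w f * _ in hX *.
pose T := Num.sqrt (D%:R * tau2) * d.+1%:R * (1 - u).
have T0 : 0 <= T by rewrite !mulr_ge0 ?sqrtr_ge0// subr_ge0.
have TS : T <= S.
  apply: le_trans hX; rewrite /T ler_wpM2l ?mulr_ge0 ?sqrtr_ge0//.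
  rewrite lerB// ler_pdivrMr ?mulr_gt0 ?exprn_gt0//.
  apply: le_trans hu; apply: ler_wpM2l => //; exact: (approx_moment4 wx).
have Dt : 0 <= D%:R * tau2 by rewrite ltW// mulr_gt0.
have : T ^+ 2 <= S ^+ 2 by rewrite ler_pXn2r ?nnegrE// (le_trans T0).
apply: le_trans; rewrite /T !exprMn sqr_sqrtr//.
rewrite le_eqVlt; apply/orP; left; apply/eqP; ring.
Qed.

End Construction.

(** The cube collects one factor lost in the second moment and two in the squared trace. The
    condition on [eta] results from [eta ^+ 2 <= eta] and [1 - 3 * eta <= (1 - eta) ^+ 3]. *)
Lemma ratio_bound (R : realType) (a eps eta : R) : 0 <= a -> 0 < eps ->
  0 <= eta -> eta <= 1 -> eta * (2 * a + 1 + 3 * a ^+ 2 + 3 * eps) <= eps ->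
  (a + eta) ^+ 2 <= (a ^+ 2 + eps) * (1 - eta) ^+ 3.
Proof.
move=> a0 eps0 eta0 eta1 h.
have e2 : eta ^+ 2 <= eta by rewrite expr2 ler_piMr.
have h3 : 1 - 3 * eta <= (1 - eta) ^+ 3.
  rewrite -subr_ge0 (_ : _ - _ = eta ^+ 2 * (3 - eta)); last by ring.
  by rewrite mulr_ge0 ?sqr_ge0// subr_ge0 (le_trans eta1)// ler1n.
have c0 : 0 <= a ^+ 2 + eps by rewrite addr_ge0 ?sqr_ge0// ltW.
by apply: le_trans (ler_wpM2l c0 h3); lra.
Qed.

Theorem theorem5 (R : realType) (d : nat) (eps : R) :
  (1 <= d)%N -> 0 < eps ->
  exists (n : nat) (C : 'M[R]_(n * d)),
    sym_psd C /\ 0 < sdp_value C /\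
    orth_value C / sdp_value C <= alpha_R (R := R) d ^+ 2 + eps.
Proof.
case: d => [//|d] _ eps0.
pose a := alpha_R (R := R) d.+1; rewrite -/a.
have a0 : 0 <= a by exact: alpha_R_ge0.
pose P : R := d.+1%:R; have P1 : 1 <= P by rewrite ler1n.
have P0 : 0 < P by rewrite ltr0n.
pose c := 2 * a + 1 + 3 * a ^+ 2 + 3 * eps.
have c0 : 0 < c.
  have := sqr_ge0 a; rewrite /c; lra.
(* [eps / c] serves [ratio_bound]; [6^-1] keeps [P * t2] above one half. *)
pose eta := Num.min 6^-1 (eps / c).
have eta0 : 0 < eta by rewrite lt_min invr_gt0 ltr0n divr_gt0.
have eta6 : eta <= 6^-1 by rewrite ge_min lexx.
have etac : eta * c <= eps by rewrite -ler_pdivlMr// ge_min lexx orbT.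
pose sd : R := (Num.sqrt d.+1%:R)^-1.
have sd0 : 0 < sd by rewrite invr_gt0 sqrtr_gt0.
have sd2 : sd ^+ 2 = P^-1 by rewrite exprVn sqr_sqrtr// ler0n.
pose K4 := gE sd (fun x => x ^+ 4).
(* Obtained from the fourth moment condition multiplied by [P ^+ 2], with
   [(P * t2) ^+ 2 >= 4^-1]. *)
pose k := (Num.truncn (2 * P ^+ 3 * K4 / eta)).+1.
pose D := (d.+1 + k)%N.
(* The coefficient of [delta] in the orthogonal bound, so the choice of [delta] makes that error
   exactly [eta]. *)
pose M := P ^+ 2 + 6 * (d.+1 * D)%:R * 2 ^+ d.+1 * P.
have PM : P <= M.
  apply: (@le_trans _ _ (P ^+ 2)); first by rewrite expr2 ler_peMl// ltW.
  by rewrite lerDl !mulr_ge0 ?exprn_ge0// ltW.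
have M0 : 0 < M by exact: lt_le_trans PM.
pose delta := eta / M.
have delta0 : 0 < delta by rewrite divr_gt0.
have Mdelta : M * delta = eta by rewrite /delta mulrC divfK// gt_eqF.
have Pdelta : P * delta <= eta by rewrite -Mdelta ler_wpM2r// ltW.
have [J [w [x [sg wx]]]] := gauss_approx_exists sd0 delta0.
have := gauss_gram_orth_value_le k (ltW delta0) wx.
have := gauss_gram_sdp_value_ge (k := k) wx (u := eta).
set C := gram _; rewrite -/P -/D -/a -/M -/K4.
set t2 := \sum_j _ => hsdp horth.
have t2ge : (1 - eta) <= P * t2.
  have := approx_moment2 wx; rewrite sd2 -/t2 -(ler_pM2l P0) mulrBr divff ?gt_eqF//.
  lra.
have t2h : 2^-1 <= P * t2 by lra.
have t20 : 0 < t2 by rewrite -(pmulr_rgt0 _ P0); lra.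
have D0 : 0 < D%:R :> R by rewrite ltr0n.
have hD : 2 * P ^+ 3 * K4 <= eta * D%:R.
  rewrite [leRHS]mulrC -ler_pdivrMr//; apply: (@le_trans _ _ k%:R).
    by apply: ltW; exact: truncnS_gt.
  by rewrite ler_nat leq_addl.
have hu : P * K4 <= eta * (2 * D%:R * t2 ^+ 2).
  have h4 : 4^-1 <= (P * t2) ^+ 2.
    have -> : 4^-1 = 2^-1 ^+ 2 :> R by field.
    by rewrite ler_pXn2r ?nnegrE// ?invr_ge0// mulr_ge0// ltW.
  have e0 : 0 <= 2 * (eta * D%:R) by rewrite !mulr_ge0// ltW.
  rewrite -(ler_pM2l (exprn_gt0 2 P0)).
  have := ler_wpM2l e0 h4; rewrite exprMn => h5.
  apply: (@le_trans _ _ (2 * (eta * D%:R) * 4^-1)); first by lra.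
  by apply: le_trans h5 _; rewrite le_eqVlt; apply/orP; left; apply/eqP; ring.
have eta1 : eta <= 1 by lra.
have {}hsdp := hsdp t20 (ltW eta0) eta1 hu.
(* One of the two factors [P] is absorbed by [t2], through [P * t2 >= 1 - eta]. *)
have sdpge : P * (1 - eta) ^+ 3 <= sdp_value C.
  apply: le_trans hsdp; rewrite exprMn.
  have -> : t2 * (P ^+ 2 * (1 - eta) ^+ 2) = P * ((P * t2) * (1 - eta) ^+ 2) by ring.
  by rewrite ler_pM2l// exprS ler_wpM2r// sqr_ge0.
have e3 : 0 < (1 - eta) ^+ 3 by rewrite exprn_gt0// subr_gt0; lra.
have sdp0 : 0 < sdp_value C by apply: lt_le_trans sdpge; rewrite mulr_gt0.
exists #|{: {ffun 'I_d.+1 * 'I_D -> J}}|, C; split; first exact: gram_psd.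
split => //; rewrite ler_pdivrMr//.
rewrite Mdelta exprMn sqr_sqrtr ?ler0n// in horth.
have ae0 : 0 <= a ^+ 2 + eps by rewrite addr_ge0 ?sqr_ge0// ltW.
apply: le_trans horth _; apply: le_trans (ler_wpM2l ae0 sdpge).
rewrite [leRHS]mulrCA ler_pM2l//; exact: ratio_bound (ltW eta0) eta1 etac.
Qed.
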